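(* Let $X=\mathrm{Spec}\,\mathbb{C}[x_1^{\pm1},\dots,x_n^{\pm1}]$ be the $n$-dimensional torus, $\mathcal{D}(X)$ the ring of differential operators on $X$, and $F(\mathcal{D}(X))$ the skew field of fractions of $\mathcal{D}(X)$. Let $W$ be a classical reflection group: the symmetric group $S_n$, the reflection group $B_n$ ($n\ge 2$), or the reflection group $D_n$ ($n\ge 4$). Then the natural action of $W$ on $X$ (specified in the context) gives an action of $W$ on $\mathcal{D}(X)$ which extends to $F(\mathcal{D}(X))$, and $F(\mathcal{D}(X))^W\cong F_n$, where $F_n$ is the skew field of fractions of the $n$-th Weyl algebra over $\mathbb{C}$.
   Context: $\mathcal{D}(X)$ is the ring of differential operators on $\mathbb{C}[x_1^{\pm1},\dots,x_n^{\pm1}]$; it is isomorphic to the localization $\tilde A_n$ of the Weyl algebra $A_n$ (generators $x_i,\partial_i$, $[\partial_i,x_j]=\delta_{ij}$) at the multiplicative set generated by $x_1,\dots,x_n$. A group $G$ acting on $\mathbb{C}[x_1^{\pm1},\dots,x_n^{\pm1}]$ by algebra automorphisms acts on $\mathcal{D}(X)$ by $g*d=g\circ d\circ g^{-1}$. For $j=1,\dots,n$ let $\tau_j^{\pm}$ be the automorphism of $\mathbb{C}[x_1^{\pm1},\dots,x_n^{\pm1}]$ with $\tau_j^{\pm}(x_j)=\pm x_j^{-1}$ and $\tau_j^\pm(x_i)=x_i$ for $i\ne j$. The induced involution $\varepsilon_{n,j}^{\pm}$ of $\tilde A_n$ satisfies $\varepsilon_{n,j}^\pm(x_i)=\tau_j^\pm(x_i)$,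 $\varepsilon_{n,j}^{\pm}(\partial_j)=\mp x_j^2\partial_j$ and $\varepsilon_{n,j}^\pm(\partial_i)=\partial_i$ for $i\neq j$. The natural actions are as follows. $S_n$ acts by permuting the indices of the variables. The group $B_n=S_n\ltimes(\mathbb{Z}/2\mathbb{Z})^n$ acts with $S_n$ permuting the variables and the $i$-th generator of $(\mathbb{Z}/2\mathbb{Z})^n$ acting by $\varepsilon_{n,i}^{-}$ (so $x_i\mapsto -x_i^{-1}$). The group $D_n=S_n\ltimes(\mathbb{Z}/2\mathbb{Z})^{n-1}$, where $(\mathbb{Z}/2\mathbb{Z})^{n-1}\subset(\mathbb{Z}/2\mathbb{Z})^n$ is the subgroup of elements $(d_1,\dots,d_n)$ with $d_1+\dots+d_n$ even, acts with $S_n$ permuting the variables and $(\mathbb{Z}/2\mathbb{Z})^{n-1}$ acting through its generators by $\varepsilon_{n,i}^{+}\varepsilon_{n,i+1}^{+}$, $i=1,\dots,n-1$ (so $x_i\mapsto x_i^{-1}$ and $x_{i+1}\mapsto x_{i+1}^{-1}$ simultaneously). *)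

(* Defs.v *)
From HB Require Import structures.
From mathcomp Require Import all_boot all_order all_algebra all_fingroup.
From mathcomp Require Import boolp functions complex mpoly reals.

Set Implicit Arguments.
Unset Strict Implicit.
Unset Printing Implicit Defensive.

Import GRing.Theory.
Local Open Scope ring_scope.
Local Open Scope quotient_scope.

Section DifferentialOperators.
Variables (k : comNzRingType) (A : comAlgType k).
Implicit Types (P Q : A -> A) (d : nat).

(* Grothendieck's filtration: P has order <= d iff [P, a] has order <= d - 1
   for all a in A, the operators of order <= 0 being the A-linear ones. *)
Fixpoint diff_order_le d P : Prop :=
  if d is e.+1 then forall a, diff_order_le e (fun f => P (a * f) - a * P f)
  else forall a f, P (a * f) = a * P f.

Definition is_diffop : {pred A -> A} :=
  fun P => `[< linear P /\ exists d, diff_order_le d P >].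

Lemma diff_order_ext d P Q : P =1 Q -> diff_order_le d P -> diff_order_le d Q.
Proof. by move=> /funext ->. Qed.

Lemma diff_order_add d P Q c : diff_order_le d P -> diff_order_le d Q ->
  diff_order_le d (fun f => c *: P f + Q f).
Proof.
elim: d P Q => [|d IHd] P Q /= dP dQ a.
  by move=> f; rewrite dP dQ mulrDr scalerAr.
apply: diff_order_ext (IHd _ _ (dP a) (dQ a)) => f.
by rewrite scalerBr mulrDr -scalerAr opprD addrACA.
Qed.

Lemma diff_order_zero d : diff_order_le d (fun=> 0 : A).
Proof.
elim: d => [|d IHd] /= a; first by move=> f; rewrite mulr0.
by apply: diff_order_ext IHd => f; rewrite mulr0 subr0.
Qed.

Lemma diff_order_mull d P a :
  diff_order_le d P -> diff_order_le d (fun f => a * P f).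
Proof.
elim: d P => [|d IHd] P /= dP b; first by move=> f; rewrite dP mulrCA.
by apply: diff_order_ext (IHd _ (dP b)) => f; rewrite mulrBr (mulrCA a b).
Qed.

Lemma diff_order_mulr d P a :
  diff_order_le d P -> diff_order_le d (fun f => P (a * f)).
Proof.
elim: d P => [|d IHd] P /= dP b; first by move=> f; rewrite !dP mulrCA.
by apply: diff_order_ext (IHd _ (dP b)) => f; rewrite mulrCA.
Qed.

Lemma diff_order_succ d P : diff_order_le d P -> diff_order_le d.+1 P.
Proof.
elim: d P => [|d IHd] P dP a.
  by move=> b f; rewrite !dP !subrr mulr0.
exact: IHd (dP a).
Qed.

Lemma diff_order_leq d e P :
  (d <= e)%N -> diff_order_le d P -> diff_order_le e P.
Proof.
move=> /subnK <-; elim: (e - d)%N => [//|m IHm] dP.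
by rewrite addSn; apply/diff_order_succ/IHm.
Qed.

Lemma diff_order_comp d e P Q : linear P ->
  diff_order_le d P -> diff_order_le e Q -> diff_order_le (d + e) (P \o Q).
Proof.
have [m] := ubnP (d + e); elim: m d e P Q => // m IHm d e P Q le_m linP dP dQ.
have PB u v : P (u - v) = P u - P v.
  by rewrite -[u - v]addrC -scaleN1r linP scaleN1r addrC.
case: d e dP dQ le_m => [|d] [|e] dP dQ le_m.
- by move=> a f /=; rewrite dQ dP.
- move=> a; have := IHm 0%N e P _ _ linP dP (dQ a); rewrite add0n => dPQ.
  by apply: diff_order_ext (dPQ _) => [f /=|]; [rewrite PB dP|].
- rewrite addn0 => a; have linPa : linear (fun f => P (a * f) - a * P f).
    move=> c u v; rewrite mulrDr -scalerAr !linP mulrDr -scalerAr opprD addrACA.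
    by rewrite scalerBr.
  have := IHm d 0 _ Q _ linPa (dP a) dQ; rewrite !addn0 in le_m * => dPQ.
  by apply: diff_order_ext (dPQ _) => [f /=|//]; rewrite dQ.
move=> a; have linPa : linear (fun f => P (a * f) - a * P f).
  move=> c u v; rewrite mulrDr -scalerAr !linP mulrDr -scalerAr opprD addrACA.
  by rewrite scalerBr.
rewrite addSn addnS in le_m.
have dPaQ : diff_order_le (d + e.+1) ((fun f => P (a * f) - a * P f) \o Q).
  by apply: IHm => //; rewrite addnS.
have dPQa : diff_order_le (d.+1 + e) (P \o (fun f => Q (a * f) - a * Q f)).
  by apply: IHm => //; rewrite addSn.
rewrite addSn -addnS in dPQa; apply: diff_order_ext (diff_order_add 1 dPaQ dPQa).
by move=> f /=; rewrite scale1r PB addrC addrA subrK.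
Qed.

Lemma diffop_submod_closed : submod_closed is_diffop.
Proof.
split=> [|c P Q /asboolP[linP [d dP]] /asboolP[linQ [e dQ]]]; apply/asboolP.
  split=> [c u v|]; first by rewrite scaler0 addr0.
  by exists 0%N => a f /=; rewrite mulr0.
split=> [b u v|].
  have PQE f : (c *: P + Q) f = c *: P f + Q f by [].
  by rewrite !PQE linP linQ !scalerDr !scalerA addrACA [c * b]mulrC.
exists (maxn d e); apply: (@diff_order_add (maxn d e) P Q c).
  exact: diff_order_leq (leq_maxl d e) dP.
exact: diff_order_leq (leq_maxr d e) dQ.
Qed.

HB.instance Definition _ :=
  GRing.isSubmodClosed.Build k (A -> A) is_diffop diffop_submod_closed.

Record diffop := DiffOp { diffop_fun :> A -> A; _ : is_diffop diffop_fun }.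

HB.instance Definition _ := [isSub for diffop_fun].
HB.instance Definition _ := [Choice of diffop by <:].
HB.instance Definition _ := [SubChoice_isSubLmodule of diffop by <:].

Lemma diffop_linear (P : diffop) : linear P.
Proof. by case: P => P /= /asboolP[]. Qed.

Lemma diffop_one_subproof : is_diffop id.
Proof. by apply/asboolP; split=> //; exists 0%N. Qed.

Lemma diffop_mul_subproof (P Q : diffop) : is_diffop (P \o Q).
Proof.
case: P Q => P /= /asboolP[linP [d dP]] [Q /= /asboolP[linQ [e dQ]]].
apply/asboolP; split=> [c u v|]; first by rewrite /= linQ linP.
by exists (d + e)%N; apply: diff_order_comp.
Qed.

Definition diffop_one := DiffOp diffop_one_subproof.
Definition diffop_mul (P Q : diffop) := DiffOp (diffop_mul_subproof P Q).

Lemma diffopP (P Q : diffop) : P =1 Q -> P = Q.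
Proof. by move=> eqPQ; apply/val_inj/funext. Qed.

Lemma diffop_mulA : associative diffop_mul.
Proof. by move=> P Q S; apply: diffopP. Qed.
Lemma diffop_mul1 : left_id diffop_one diffop_mul.
Proof. by move=> P; apply: diffopP. Qed.
Lemma diffop_mulr1 : right_id diffop_one diffop_mul.
Proof. by move=> P; apply: diffopP. Qed.
Lemma diffop_mulDl : left_distributive diffop_mul +%R.
Proof. by move=> P Q S; apply: diffopP. Qed.
Lemma diffop_mulDr : right_distributive diffop_mul +%R.
Proof.
move=> P Q S; apply: diffopP => f /=.
by have := diffop_linear P 1 (Q f) (S f); rewrite !scale1r.
Qed.
Lemma diffop_oner_neq0 : diffop_one != 0.
Proof.
apply/eqP => /(congr1 (fun P : diffop => P 1)) /= /eqP.
by rewrite (negPf (oner_neq0 A)).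
Qed.

HB.instance Definition _ := GRing.Zmodule_isNzRing.Build diffop
  diffop_mulA diffop_mul1 diffop_mulr1 diffop_mulDl diffop_mulDr
  diffop_oner_neq0.

Lemma diffop_scaleAl (c : k) (P Q : diffop) : c *: (P * Q) = c *: P * Q.
Proof. by apply: diffopP. Qed.

HB.instance Definition _ :=
  GRing.Lmodule_isLalgebra.Build k diffop diffop_scaleAl.

Lemma diffop_scaleAr (c : k) (P Q : diffop) : c *: (P * Q) = P * (c *: Q).
Proof.
apply: diffopP => f; have P0 : P 0 = 0.
  by have := diffop_linear P (-1) 0 0; rewrite scaler0 addr0 scaleN1r addNr.
by have := diffop_linear P c (Q f) 0; rewrite !addr0 P0 addr0.
Qed.

HB.instance Definition _ :=
  GRing.Lalgebra_isAlgebra.Build k diffop diffop_scaleAr.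

End DifferentialOperators.

Section LaurentPolynomials.
Variables (k : fieldType) (n : nat).

Local Notation Fx := {fraction {mpoly k[n]}}.
Local Notation tofrac := (@FracField.tofrac {mpoly k[n]}).

(* k[x_1^{+-1}, ..., x_n^{+-1}] as the localization of k[x_1, ..., x_n] at the
   monomials, realized inside k(x_1, ..., x_n). *)
Definition is_laurent : {pred Fx} :=
  fun f => `[< exists p (m : 'X_{1..n}), f = tofrac p / tofrac 'X_[m] >].

Lemma tofracX_neq0 (m : 'X_{1..n}) : tofrac 'X_[m] != 0.
Proof.
rewrite tofrac_eq0; apply/eqP => /(congr1 (mcoeff m)) /eqP.
by rewrite mcoeffX eqxx mcoeff0 oner_eq0.
Qed.

Lemma is_laurent_poly p : is_laurent (tofrac p).
Proof.
apply/asboolP; exists p, 0%MM.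
by rewrite mpolyX0 tofrac1 divr1.
Qed.

Lemma is_laurentV m : is_laurent (tofrac 'X_[m])^-1.
Proof. by apply/asboolP; exists 1, m; rewrite tofrac1 mul1r. Qed.

Lemma laurent_subring_closed : subring_closed is_laurent.
Proof.
split=> [|_ _ /asboolP[p [a ->]] /asboolP[q [b ->]]|
          _ _ /asboolP[p [a ->]] /asboolP[q [b ->]]].
- by rewrite -tofrac1; apply: is_laurent_poly.
- apply/asboolP; exists (p * 'X_[b] - q * 'X_[a]), (a + b)%MM.
  rewrite mpolyXD tofracB !tofracM -mulNr addf_div ?tofracX_neq0 //.
  by rewrite mulNr.
apply/asboolP; exists (p * q), (a + b)%MM.
by rewrite mpolyXD !tofracM mulf_div.
Qed.

HB.instance Definition _ :=
  GRing.isSubringClosed.Build Fx is_laurent laurent_subring_closed.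

Record laurent := Laurent { laurent_val :> Fx; _ : is_laurent laurent_val }.

HB.instance Definition _ := [isSub for laurent_val].
HB.instance Definition _ := [Choice of laurent by <:].
HB.instance Definition _ := [SubChoice_isSubComNzRing of laurent by <:].

Definition laurent_const (c : k) : laurent := Laurent (is_laurent_poly c%:MP).
Definition laurent_scale (c : k) (f : laurent) := laurent_const c * f.

Lemma laurent_scaleA a b f :
  laurent_scale a (laurent_scale b f) = laurent_scale (a * b) f.
Proof. by apply: val_inj; rewrite /= mulrA -tofracM -mpolyCM. Qed.
Lemma laurent_scale1 : left_id 1 laurent_scale.
Proof. by move=> f; apply: val_inj; rewrite /= mpolyC1 tofrac1 mul1r. Qed.
Lemma laurent_scaleDr : right_distributive laurent_scale +%R.
Proof. by move=> a f g; rewrite /laurent_scale mulrDr. Qed.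
Lemma laurent_scaleDl f : {morph laurent_scale^~ f : a b / a + b}.
Proof. by move=> a b; apply: val_inj; rewrite /= mpolyCD tofracD mulrDl. Qed.

HB.instance Definition _ := GRing.Zmodule_isLmodule.Build k laurent
  laurent_scaleA laurent_scale1 laurent_scaleDr laurent_scaleDl.

Lemma laurent_scaleAl (c : k) (f g : laurent) : c *: (f * g) = c *: f * g.
Proof. exact: mulrA. Qed.

HB.instance Definition _ :=
  GRing.Lmodule_isLalgebra.Build k laurent laurent_scaleAl.
HB.instance Definition _ := GRing.Lalgebra_isComAlgebra.Build k laurent.

Definition lX (i : 'I_n) : laurent := Laurent (is_laurent_poly 'X_i).
Definition lXV (i : 'I_n) : laurent := Laurent (is_laurentV U_(i)).

End LaurentPolynomials.

Section WeylAlgebra.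
Variables (k : fieldType) (n : nat).

(* The algebra presented by generators x_i, d_i and the relations
   x_i x_j = x_j x_i, d_i d_j = d_j d_i, d_i x_j - x_j d_i = delta_ij:
   formal expressions modulo the least congruence containing the k-algebra
   axioms and these relations. *)
Inductive weyl_term : Type :=
  | WX of 'I_n
  | WD of 'I_n
  | WConst of k
  | WAdd of weyl_term & weyl_term
  | WMul of weyl_term & weyl_term.

Local Notation "s + t" := (WAdd s t).
Local Notation "s * t" := (WMul s t).

Inductive weyl_eq : weyl_term -> weyl_term -> Prop :=
  | weyl_refl s : weyl_eq s s
  | weyl_sym s t : weyl_eq s t -> weyl_eq t s
  | weyl_trans t s u : weyl_eq s t -> weyl_eq t u -> weyl_eq s u
  | weyl_add s s' t t' : weyl_eq s s' -> weyl_eq t t' ->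
      weyl_eq (s + t) (s' + t')
  | weyl_mul s s' t t' : weyl_eq s s' -> weyl_eq t t' ->
      weyl_eq (s * t) (s' * t')
  | weyl_addA s t u : weyl_eq (s + (t + u)) (s + t + u)
  | weyl_addC s t : weyl_eq (s + t) (t + s)
  | weyl_add0 s : weyl_eq (WConst 0 + s) s
  | weyl_mulA s t u : weyl_eq (s * (t * u)) (s * t * u)
  | weyl_mul1 s : weyl_eq (WConst 1 * s) s
  | weyl_mul0 s : weyl_eq (WConst 0 * s) (WConst 0)
  | weyl_mulDl s t u : weyl_eq ((s + t) * u) (s * u + t * u)
  | weyl_mulDr s t u : weyl_eq (s * (t + u)) (s * t + s * u)
  | weyl_constD a b : weyl_eq (WConst (a + b)%R) (WConst a + WConst b)
  | weyl_constM a b : weyl_eq (WConst (a * b)%R) (WConst a * WConst b)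
  | weyl_constC a s : weyl_eq (WConst a * s) (s * WConst a)
  | weyl_XX i j : weyl_eq (WX i * WX j) (WX j * WX i)
  | weyl_DD i j : weyl_eq (WD i * WD j) (WD j * WD i)
  | weyl_DX i j :
      weyl_eq (WD i * WX j) (WX j * WD i + WConst (i == j)%:R).

(* Operators on k[x_1, ..., x_n]; they show that 1 <> 0 in the quotient. *)
Fixpoint weyl_op (s : weyl_term) (p : {mpoly k[n]}) : {mpoly k[n]} :=
  match s with
  | WX i => ('X_i * p)%R
  | WD i => p^`M(i)
  | WConst c => c *: p
  | WAdd s t => (weyl_op s p + weyl_op t p)%R
  | WMul s t => weyl_op s (weyl_op t p)
  end.

Lemma weyl_op_linear s : linear (weyl_op s).
Proof.
elim: s => [i|i|c|s IHs t IHt|s IHs t IHt] a p q /=.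
- by rewrite mulrDr scalerAr.
- exact: linearP.
- by rewrite scalerDr !scalerA mulrC.
- by rewrite IHs IHt scalerDr addrACA.
- by rewrite IHt IHs.
Qed.

Lemma weyl_op_eq s t : weyl_eq s t -> weyl_op s =1 weyl_op t.
Proof.
elim=> {s t} //=.
- by move=> s t _ IH p; rewrite IH.
- by move=> t s u _ IH1 _ IH2 p; rewrite IH1.
- by move=> s s' t t' _ IHs _ IHt p; rewrite IHs IHt.
- by move=> s s' t t' _ IHs _ IHt p; rewrite IHt IHs.
- by move=> s t u p; rewrite addrA.
- by move=> s t p; rewrite addrC.
- by move=> s p; rewrite scale0r add0r.
- by move=> s p; rewrite scale1r.
- by move=> s p; rewrite !scale0r.
- move=> s t u p.
  by have := weyl_op_linear s 1 (weyl_op t p) (weyl_op u p); rewrite !scale1r.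
- by move=> a b p; rewrite scalerDl.
- by move=> a b p; rewrite scalerA.
- move=> a s p; have s0 : weyl_op s 0 = 0.
    by have := weyl_op_linear s (-1) 0 0; rewrite scaler0 addr0 scaleN1r addNr.
  by have := weyl_op_linear s a p 0; rewrite !addr0 s0 addr0.
- by move=> i j p; rewrite mulrCA.
- by move=> i j p; rewrite mderiv_comm.
- move=> i j p; rewrite mderivM mderivX mnm1E addrC; congr (_ + _)%R.
  case: eqVneq => [->|_]; last by rewrite !scale0r mul0r.
  have -> : (U_(i) - U_(i))%MM = 0%MM :> 'X_{1..n}.
    by apply/mnmP => l; rewrite mnmBE subnn mnm0E.
  by rewrite mpolyX0 !scale1r mul1r.
Qed.

Definition weyl_eqb s t := `[< weyl_eq s t >].

Lemma weyl_eqb_refl : reflexive weyl_eqb.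
Proof. by move=> s; apply/asboolP/weyl_refl. Qed.
Lemma weyl_eqb_sym : ssrbool.symmetric weyl_eqb.
Proof. by move=> s t; apply/asboolP/asboolP => /weyl_sym. Qed.
Lemma weyl_eqb_trans : transitive weyl_eqb.
Proof.
by move=> t s u /asboolP st /asboolP tu; apply/asboolP/(weyl_trans st tu).
Qed.

HB.instance Definition _ := gen_eqMixin weyl_term.
HB.instance Definition _ := gen_choiceMixin weyl_term.

Canonical weyl_equiv :=
  EquivRel weyl_eqb weyl_eqb_refl weyl_eqb_sym weyl_eqb_trans.

Definition weyl := {eq_quot weyl_equiv}.
HB.instance Definition _ := Choice.on weyl.
HB.instance Definition _ := EqQuotient.on weyl.

Local Notation repr := generic_quotient.repr.
Definition weyl_pi (s : weyl_term) : weyl := \pi_weyl s.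

Lemma weyl_piP s t : weyl_eq s t -> weyl_pi s = weyl_pi t.
Proof. by move=> st; apply/eqmodP/asboolP. Qed.

Lemma weyl_repr s : weyl_eq (repr (weyl_pi s)) s.
Proof. by apply/asboolP; have /eqmodP := reprK (weyl_pi s). Qed.

Lemma weyl_ind (P : weyl -> Prop) : (forall s, P (weyl_pi s)) -> forall u, P u.
Proof. by move=> Ppi; elim/quotW. Qed.

Definition weyl_addq (u v : weyl) := weyl_pi (repr u + repr v).
Definition weyl_mulq (u v : weyl) := weyl_pi (repr u * repr v).
Definition weyl_oppq (u : weyl) := weyl_pi (WConst (-1) * repr u).
Definition weyl_scaleq (a : k) (u : weyl) := weyl_pi (WConst a * repr u).

Lemma weyl_addqE s t : weyl_addq (weyl_pi s) (weyl_pi t) = weyl_pi (s + t).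
Proof. by apply/weyl_piP/weyl_add; apply: weyl_repr. Qed.
Lemma weyl_mulqE s t : weyl_mulq (weyl_pi s) (weyl_pi t) = weyl_pi (s * t).
Proof. by apply/weyl_piP/weyl_mul; apply: weyl_repr. Qed.
Lemma weyl_oppqE s : weyl_oppq (weyl_pi s) = weyl_pi (WConst (-1) * s).
Proof. by apply/weyl_piP/weyl_mul; [apply: weyl_refl|apply: weyl_repr]. Qed.
Lemma weyl_scaleqE a s : weyl_scaleq a (weyl_pi s) = weyl_pi (WConst a * s).
Proof. by apply/weyl_piP/weyl_mul; [apply: weyl_refl|apply: weyl_repr]. Qed.

Let piE := (weyl_addqE, weyl_mulqE, weyl_oppqE, weyl_scaleqE).

Lemma weyl_addqA : associative weyl_addq.
Proof.
elim/weyl_ind=> s; elim/weyl_ind=> t; elim/weyl_ind=> u; rewrite !piE.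
exact/weyl_piP/weyl_addA.
Qed.
Lemma weyl_addqC : commutative weyl_addq.
Proof.
by elim/weyl_ind=> s; elim/weyl_ind=> t; rewrite !piE; apply/weyl_piP/weyl_addC.
Qed.
Lemma weyl_add0q : left_id (weyl_pi (WConst 0)) weyl_addq.
Proof. by elim/weyl_ind=> s; rewrite !piE; apply/weyl_piP/weyl_add0. Qed.
Lemma weyl_addNq : left_inverse (weyl_pi (WConst 0)) weyl_oppq weyl_addq.
Proof.
elim/weyl_ind=> s; rewrite !piE; apply/weyl_piP.
apply: weyl_trans (weyl_mul0 s).
apply: (@weyl_trans ((WConst (-1) + WConst 1) * s)); last first.
  apply: weyl_mul (weyl_refl _).
  by have := weyl_constD (-1) 1; rewrite addNr => /weyl_sym.
apply: weyl_trans (weyl_sym (weyl_mulDl _ _ _)).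
exact: weyl_add (weyl_refl _) (weyl_sym (weyl_mul1 _)).
Qed.

HB.instance Definition _ := GRing.isZmodule.Build weyl
  weyl_addqA weyl_addqC weyl_add0q weyl_addNq.

Lemma weyl_mulqA : associative weyl_mulq.
Proof.
elim/weyl_ind=> s; elim/weyl_ind=> t; elim/weyl_ind=> u; rewrite !piE.
exact/weyl_piP/weyl_mulA.
Qed.
Lemma weyl_mul1q : left_id (weyl_pi (WConst 1)) weyl_mulq.
Proof. by elim/weyl_ind=> s; rewrite !piE; apply/weyl_piP/weyl_mul1. Qed.
Lemma weyl_mulq1 : right_id (weyl_pi (WConst 1)) weyl_mulq.
Proof.
elim/weyl_ind=> s; rewrite !piE; apply/weyl_piP.
exact: weyl_trans (weyl_sym (weyl_constC _ _)) (weyl_mul1 _).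
Qed.
Lemma weyl_mulqDl : left_distributive weyl_mulq weyl_addq.
Proof.
elim/weyl_ind=> s; elim/weyl_ind=> t; elim/weyl_ind=> u; rewrite !piE.
exact/weyl_piP/weyl_mulDl.
Qed.
Lemma weyl_mulqDr : right_distributive weyl_mulq weyl_addq.
Proof.
elim/weyl_ind=> s; elim/weyl_ind=> t; elim/weyl_ind=> u; rewrite !piE.
exact/weyl_piP/weyl_mulDr.
Qed.
Lemma weyl_oner_neq0 : weyl_pi (WConst 1) != weyl_pi (WConst 0).
Proof.
apply/eqP => /eqmodP /asboolP /weyl_op_eq /(_ 1) /= /eqP.
by rewrite scale1r scale0r oner_eq0.
Qed.

HB.instance Definition _ := GRing.Zmodule_isNzRing.Build weyl
  weyl_mulqA weyl_mul1q weyl_mulq1 weyl_mulqDl weyl_mulqDr weyl_oner_neq0.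

Lemma weyl_scaleqA a b (u : weyl) :
  weyl_scaleq a (weyl_scaleq b u) = weyl_scaleq (a * b)%R u.
Proof.
elim/weyl_ind: u => s; rewrite !piE; apply/weyl_piP.
apply: weyl_trans (weyl_mulA _ _ _) _.
exact: weyl_mul (weyl_sym (weyl_constM _ _)) (weyl_refl _).
Qed.
Lemma weyl_scaleq1 : left_id 1 weyl_scaleq.
Proof. by elim/weyl_ind=> s; rewrite !piE; apply/weyl_piP/weyl_mul1. Qed.
Lemma weyl_scaleqDr : right_distributive weyl_scaleq +%R.
Proof.
move=> a; elim/weyl_ind=> s; elim/weyl_ind=> t; rewrite /GRing.add /= !piE.
exact/weyl_piP/weyl_mulDr.
Qed.
Lemma weyl_scaleqDl (u : weyl) : {morph weyl_scaleq^~ u : a b / (a + b)%R}.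
Proof.
move=> a b; elim/weyl_ind: u => s; rewrite {2}/GRing.add /= !piE.
apply/weyl_piP/(weyl_trans _ (weyl_mulDl _ _ _)).
exact: weyl_mul (weyl_constD _ _) (weyl_refl _).
Qed.

HB.instance Definition _ := GRing.Zmodule_isLmodule.Build k weyl
  weyl_scaleqA weyl_scaleq1 weyl_scaleqDr weyl_scaleqDl.

Lemma weyl_scaleqAl (a : k) (u v : weyl) : a *: (u * v)%R = ((a *: u) * v)%R.
Proof.
elim/weyl_ind: u => s; elim/weyl_ind: v => t.
rewrite /GRing.scale /GRing.mul /= !piE; exact/weyl_piP/weyl_mulA.
Qed.

HB.instance Definition _ :=
  GRing.Lmodule_isLalgebra.Build k weyl weyl_scaleqAl.

Lemma weyl_scaleqAr (a : k) (u v : weyl) : a *: (u * v)%R = (u * (a *: v))%R.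
Proof.
elim/weyl_ind: u => s; elim/weyl_ind: v => t.
rewrite /GRing.scale /GRing.mul /= !piE; apply/weyl_piP.
apply: weyl_trans (weyl_mulA _ _ _) _.
apply: weyl_trans (weyl_mul (weyl_constC _ _) (weyl_refl _)) _.
exact/weyl_sym/weyl_mulA.
Qed.

HB.instance Definition _ :=
  GRing.Lalgebra_isAlgebra.Build k weyl weyl_scaleqAr.

End WeylAlgebra.

Section ClassicalReflectionGroups.
Variable n : nat.

(* As the product s * t of permutations maps i to t (s i), all actions are right
   actions; S_n moves the i-th entry of a sign vector to position s i. *)
Definition sign_perm (v : 'rV['Z_2]_n) (s : 'S_n) : 'rV['Z_2]_n :=
  col_perm s^-1%g v.

Lemma sign_perm1 v : sign_perm v 1%g = v.
Proof. by rewrite /sign_perm invg1 col_perm1. Qed.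
Lemma sign_permM v s t : sign_perm v (s * t)%g = sign_perm (sign_perm v s) t.
Proof. by apply/rowP => j; rewrite !mxE invMg permM. Qed.

Canonical sign_action := TotalAction sign_perm1 sign_permM.

Lemma sign_is_groupAction : is_groupAction [set: 'rV['Z_2]_n] sign_action.
Proof.
move=> s _; rewrite inE; apply/andP; split.
  by apply/subsetP => v _; rewrite inE.
apply/morphicP => u v _ _; rewrite !actpermE.
by apply/rowP => j; rewrite !mxE.
Qed.

Canonical sign_groupAction := GroupAction sign_is_groupAction.

(* S_n |x (Z/2)^n *)
Definition Bn : finGroupType := sdprod_by sign_groupAction.

Definition Bn_perm (s : 'S_n) : Bn := sdpair2 sign_groupAction s.
Definition Bn_sign (v : 'rV['Z_2]_n) : Bn := sdpair1 sign_groupAction v.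

Definition Dn : {set Bn} := [set w : Bn | \sum_j w.2 0 j == 0].

Lemma Dn_group_set : group_set Dn.
Proof.
apply/group_setP; split=> [|u v].
  by rewrite inE; apply/eqP; rewrite big1 // => j _; rewrite mxE.
rewrite !inE => /eqP u0 /eqP v0; apply/eqP => /=.
under eq_bigr => j _ do rewrite !mxE.
rewrite big_split /= v0 addr0 -[RHS]u0.
by rewrite (reindex_inj (@perm_inj _ v.1)) /=; apply: eq_bigr => j _; rewrite permK.
Qed.

Canonical Dn_group := Group Dn_group_set.

End ClassicalReflectionGroups.

Section Noether.
Variables (k : fieldType) (n : nat).

Local Notation L := (laurent k n).
Local Notation D := (diffop L).

(* Skew field of right fractions of A; it is unique up to isomorphism over A. *)
Definition is_skew_fraction_field (A : algType k) (K : unitAlgType k)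
    (iota : {lrmorphism A -> K}) : Prop :=
  [/\ forall y : K, y != 0 -> y \is a GRing.unit,
      injective iota
    & forall y : K, exists a s, s != 0 /\ y = iota a / iota s].

Definition acts_by_automorphisms (gT : finGroupType) (G : {group gT})
    (A : algType k) (a : action G A) : Prop :=
  {in G, forall g, linear (a^~ g) /\ monoid_morphism (a^~ g)}.

Definition Sn_natural (a : action [set: 'S_n] L) : Prop :=
  forall s i, a (lX k i) s = lX k (s i).

(* For c = 1 or -1: x_i |-> c x_i^{-1} for all i with v_i = 1. *)
Definition signed_natural (c : k) (G : {group Bn n}) (a : action G L) : Prop :=
  (forall s i, Bn_perm s \in G -> a (lX k i) (Bn_perm s) = lX k (s i)) /\
  (forall v i, Bn_sign v \in G ->
     a (lX k i) (Bn_sign v) = if v 0 i == 0 then lX k i else c *: lXV k i).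

(* g * d = g o d o g^-1 *)
Definition induced_action (gT : finGroupType) (G : {group gT})
    (a : action G L) (b : action G D) : Prop :=
  {in G, forall g (d : D) f, b d g (a f g) = a (d f) g}.

Definition extends_action (gT : finGroupType) (G : {group gT})
    (K : unitAlgType k) (iota : D -> K) (b : action G D) (c : action G K) :
    Prop :=
  {in G, forall g d, c (iota d) g = iota (b d g)}.

Definition invariants_iso (gT : finGroupType) (G : {group gT})
    (K F : unitAlgType k) (c : action G K) : Prop :=
  exists phi : {lrmorphism F -> K}, injective phi /\
    forall y, (exists z, phi z = y) <-> {in G, forall g, c y g = y}.

(* Each of the actions is determined on G by the previous one. *)
Definition noncommutative_noether (gT : finGroupType) (G : {group gT})
    (natural : action G L -> Prop) (K F : unitAlgType k) (iota : D -> K) :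
    Prop :=
  exists a : action G L, [/\ acts_by_automorphisms a, natural a &
  exists b : action G D, [/\ acts_by_automorphisms b, induced_action a b &
  exists c : action G K, [/\ acts_by_automorphisms c,
    extends_action iota b c & invariants_iso F c]]].

End Noether.

(* Main.v *)
Require Import Defs.
From HB Require Import structures.
From mathcomp Require Import all_boot all_order all_algebra all_fingroup.
From mathcomp Require Import boolp functions complex mpoly reals ring.

Set Implicit Arguments.
Unset Strict Implicit.
Unset Printing Implicit Defensive.

Import GRing.Theory.
Local Open Scope ring_scope.

(* Let K = F(D(X)), let M be the subfield of rational functions on the torus and
   suppose that M^W is generated as a field by invariants y_1, .., y_n. By Artin
   M is finite over M^W, so (characteristic 0) a derivation of M killing the y_i
   is zero. Hence the y_i have unique dual derivations d_i in the M-span of the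
   partial derivatives, and uniqueness makes the d_i commute and be W-invariant.
   So y_i, d_i generate a Weyl algebra, whose skew field of fractions Q embeds
   in K^W. The span MQ is a finite-dimensional right Q-space stable under left
   multiplication by D(X); powers of s in D(X) are then dependent over Q, so MQ
   contains 1/s and MQ = K. Write an invariant as sum b_i q_i with b_i in M;
   averaging over W replaces b_i by its trace, which is in M^W: so K^W = Q.
   It remains to find the y_i: elementary symmetric functions e_j(x) for S_n,
   e_j(u) with u_i = x_i - 1/x_i for B_n, and, with u_i = x_i + 1/x_i,
   e_1(u), .., e_(n-2)(u), prod (u_i - 2) and prod (x_i - 1/x_i) for D_n. *)

(** * Linear algebra over skew fields *)

(** The only input that depends on the group is the rationality of M^W. It is stated as a closure
    property of subalgebras of the Laurent polynomials, so that it never mentions K. All linear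
    algebra rests on one fact, valid over every skew field: a homogeneous system with fewer
    equations than unknowns has a nontrivial solution. It yields the finiteness of M over M^W, the
    dual derivations and the relation between powers of s. Sides matter: fractions are a/s with the
    denominator on the right, and Q acts on the right of MQ, so left multiplication by D(X) is
    Q-linear and a/s lies in MQ as soon as 1/s does. For D_n the evident generators e_1(u), ..,
    e_n(u) and delta = prod (x_i - 1/x_i) are one too many. Since (x - 1/x)^2 = (u - 2)(u + 2),
    delta^2 factors as A B with A = prod (u_i - 2) and B = prod (u_i + 2). Replacing e_(n-1) and e_n
    by A and B makes B = delta^2 / A redundant; this is where the constant 2 comes from. *)

Section SkewLinearAlgebra.
Variables (K : unitRingType).
Hypothesis skewK : forall y : K, y != 0 -> y \is a GRing.unit.

Lemma skew_mulf_eq0 (x y : K) : x * y = 0 -> x != 0 -> y = 0.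
Proof. by move=> xy0 /skewK Ux; rewrite -[y](mulKr Ux) xy0 mulr0. Qed.

(** Gaussian elimination with coefficients on the left and unknowns on the right: a pivot in the
    first row removes one equation and one unknown. The division subring [Q] is carried along
    because the solution is needed with entries in the same subring as the coefficients. *)
Lemma skew_solve (Q : divringClosed K) n m (A : 'I_n -> 'I_m -> K) :
  (n < m)%N -> (forall i j, A i j \in Q) ->
  exists z : 'I_m -> K, [/\ forall j, z j \in Q, exists j, z j != 0
    & forall i, \sum_j A i j * z j = 0].
Proof.
elim: n m A => [|n IHn] [//|m] A lt_nm QA.
  exists (fun=> 1); split=> [j||[]//]; first exact: rpred1.
  by exists ord0; rewrite oner_neq0.
have [/existsP[j0 nz]|/existsPn z0] := boolP [exists j, A ord0 j != 0];
  last first.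
  have [|z [Qz nz eqz]] := IHn m.+1 (fun i => A (lift ord0 i)) (ltnW lt_nm).
    by move=> i j; apply: QA.
  exists z; split=> // i; case: (unliftP ord0 i) => [i' ->|->];
    first exact: eqz.
  rewrite big1 // => j _.
  by have /negPn/eqP -> := z0 j; rewrite mul0r.
pose p := (A ord0 j0)^-1.
pose A' i j := A (lift ord0 i) (lift j0 j)
  - A (lift ord0 i) j0 * p * A ord0 (lift j0 j).
have Qp : p \in Q by rewrite rpredVr ?QA.
have [|z [Qz [j1 nz1] eqz]] := IHn m A' lt_nm.
  by move=> i j; rewrite rpredB ?rpredM ?QA.
(* The value of the unknown [j0] that the first equation forces once the others are known. *)
pose t := - p * \sum_j A ord0 (lift j0 j) * z j.
have Qt : t \in Q.
  by rewrite rpredM ?rpredN // rpred_sum // => j _; rewrite rpredM ?QA.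
exists (fun j => if unlift j0 j is Some j' then z j' else t); split=> [j||i].
- by case: unliftP => [j' _|_] //.
- by exists (lift j0 j1); rewrite liftK.
rewrite (bigD1_ord j0) //= unlift_none.
under eq_bigr => j _ do rewrite liftK.
case: (unliftP ord0 i) => [i' ->|->]; last first.
  by rewrite /t mulrA mulrN divrr ?skewK // mulN1r addNr.
rewrite -[RHS](eqz i') /A'; under [RHS]eq_bigr => j _ do
  rewrite mulrBl -!mulrA.
rewrite sumrB addrC -!mulr_sumr; congr (_ + _).
by rewrite /t mulNr mulrN.
Qed.

(** Coefficients act on the right, so that left multiplications are linear maps. *)
Definition rspan (Q : divringClosed K) r (b : 'I_r -> K) (v : K) :=
  exists q : 'I_r -> K, (forall i, q i \in Q) /\ v = \sum_i b i * q i.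

Section Span.
Variables (Q : divringClosed K) (r : nat) (b : 'I_r -> K).

Lemma rspan0 : rspan Q b 0.
Proof.
by exists (fun=> 0); split=> [_|]; rewrite ?rpred0 // big1 // => i _;
  rewrite mulr0.
Qed.

Lemma rspanD u v : rspan Q b u -> rspan Q b v -> rspan Q b (u + v).
Proof.
move=> [p [Qp ->]] [q [Qq ->]]; exists (fun i => p i + q i).
split=> [i|]; first by rewrite rpredD.
by rewrite -big_split; apply: eq_bigr => i _; rewrite mulrDr.
Qed.

Lemma rspanZ u q : rspan Q b u -> q \in Q -> rspan Q b (u * q).
Proof.
move=> [p [Qp ->]] Qq; exists (fun i => p i * q).
split=> [i|]; first by rewrite rpredM.
by rewrite mulr_suml; apply: eq_bigr => i _; rewrite mulrA.
Qed.

Lemma rspan_sum (I : finType) (F : I -> K) :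
  (forall i, rspan Q b (F i)) -> rspan Q b (\sum_i F i).
Proof.
by move=> bF; elim/big_ind: _ => //; [exact: rspan0|exact: rspanD].
Qed.

(* A relation between powers of s yields an inverse of s once its lowest term
   is isolated. *)
Lemma relation_inv_span (s : K) m (z : 'I_m -> K) : s != 0 ->
  (forall j : nat, rspan Q b (s ^+ j)) -> (forall j, z j \in Q) ->
  (exists j, z j != 0) -> \sum_(j < m) s ^+ j * z j = 0 -> rspan Q b s^-1.
Proof.
move=> nzs bs; elim: m z => [|m IHm] z Qz [j nzj]; first by case: j nzj.
rewrite big_ord_recl expr0 mul1r.
under eq_bigr => i _ do rewrite lift0 exprS -mulrA.
rewrite -mulr_sumr; have [z00|nz0 /eqP] := eqVneq (z ord0) 0.
  rewrite z00 add0r => /skew_mulf_eq0/(_ nzs); apply: IHm => [i|];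
    first exact: Qz.
  case: (unliftP ord0 j) nzj => [i ->|->]; first by exists i.
  by rewrite z00 eqxx.
rewrite addr_eq0 => /eqP z0E.
have -> : s^-1 = (\sum_(i < m) s ^+ i * z (lift ord0 i)) * - (z ord0)^-1.
  rewrite -[RHS](mulKr (skewK nzs)) (mulrA s) mulrN -mulNr -z0E divrr ?mulr1 //.
  exact: skewK.
apply: rspanZ; last by rewrite rpredN rpredVr.
by apply: rspan_sum => i; apply: rspanZ.
Qed.

(** The [r.+1] first powers of [s] have [r] coordinates each, so some combination of them has all
    its coordinates zero. *)
Lemma inv_in_span (s : K) : s != 0 ->
  (forall j : nat, rspan Q b (s ^+ j)) -> rspan Q b s^-1.
Proof.
move=> nzs bs; have /choice[A As] : forall j : nat, exists q : 'I_r -> K,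
  (forall i, q i \in Q) /\ s ^+ j = \sum_i b i * q i by [].
have [z [Qz nzz eqz]] : exists z : 'I_r.+1 -> K, [/\ forall j, z j \in Q,
    exists j, z j != 0 & forall i, \sum_(j < r.+1) A j i * z j = 0].
  by apply: skew_solve => // i j; have [] := As j.
apply: (@relation_inv_span _ r.+1 z) => //.
under eq_bigr => j _ do rewrite (As j).2 mulr_suml.
rewrite exchange_big big1 //= => i _.
by under eq_bigr => j _ do rewrite -mulrA; rewrite -mulr_sumr eqz mulr0.
Qed.

End Span.
End SkewLinearAlgebra.

(** Packs a closure proof into a structure, so that the [rpred] lemmas apply to predicates
    introduced in the middle of a proof. *)
Definition divalg_pred (k : comUnitRingType) (K : unitAlgType k) (S : {pred K})
    (clS : divalg_closed S) : divalgClosed K :=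
  HB.pack S (GRing.isDivalgClosed.Build k K S clS).

Section AlgebraMorphism.
Variables (k : nzRingType) (A B : algType k) (f : A -> B).
Hypotheses (linf : linear f) (mulf : monoid_morphism f).
(** Instances attach to a head constant; [g] wraps an arbitrary [f] together with the two proofs, so
    that they can be declared for it. *)
Let g (lin : linear f) (mul : monoid_morphism f) := f.
HB.instance Definition _ := GRing.isLinear.Build k A B *:%R (g linf mulf) linf.
HB.instance Definition _ :=
  GRing.isMonoidMorphism.Build A B (g linf mulf) mulf.
Definition algebra_morphism : {lrmorphism A -> B} := g linf mulf.
End AlgebraMorphism.

Section Commutator.
Variable A : nzRingType.
Implicit Types x y z : A.

Definition ad x y := x * y - y * x.

Lemma adD x y z : ad x (y + z) = ad x y + ad x z.
Proof. by rewrite /ad mulrDr mulrDl opprD addrACA. Qed.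

Lemma ad_sum x (I : finType) (F : I -> A) :
  ad x (\sum_i F i) = \sum_i ad x (F i).
Proof. by rewrite /ad mulr_sumr mulr_suml sumrB. Qed.

Lemma adMr x y z : ad x (y * z) = ad x y * z + y * ad x z.
Proof. by rewrite /ad mulrBl mulrBr !mulrA subrKA. Qed.

Lemma adMl x y z : ad (x * y) z = x * ad y z + ad x z * y.
Proof. by rewrite /ad mulrBl mulrBr !mulrA subrKA. Qed.

Lemma adBl x y z : ad (x - y) z = ad x z - ad y z.
Proof. by rewrite /ad mulrBl mulrBr !opprD addrACA. Qed.

Lemma jacobi x y z : ad (ad x y) z = ad x (ad y z) - ad y (ad x z).
Proof.
rewrite [ad x y]/ad adBl !adMl [ad x (ad y z)]/ad [ad y (ad x z)]/ad.
by rewrite opprB opprD [- (y * _) - _]addrC addrACA.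
Qed.

Lemma ad_comm x y : GRing.comm x y -> ad x y = 0.
Proof. by rewrite /ad => ->; rewrite subrr. Qed.

Lemma ad_eq0 x y : ad x y = 0 -> x * y = y * x.
Proof. by move/eqP; rewrite subr_eq0 => /eqP. Qed.

Lemma adX x y m : GRing.comm y (ad x y) ->
  ad x (y ^+ m.+1) = (y ^+ m * ad x y) *+ m.+1.
Proof.
move=> cy; elim: m => [|m IHm]; first by rewrite expr0 mul1r.
rewrite exprSr adMr IHm [RHS]mulrSr; congr (_ + _).
by rewrite mulrnAl -mulrA -cy mulrA -!exprSr.
Qed.

End Commutator.

Lemma rmorph_ad (A B : nzRingType) (f : {rmorphism A -> B}) x y :
  f (ad x y) = ad (f x) (f y).
Proof. by rewrite rmorphB !rmorphM. Qed.

(** * Finite groups acting on a skew field *)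

Section GroupAction.
Variables (k : fieldType) (gT : finGroupType) (G : {group gT}).

Lemma act_lrmorphism (A : algType k) (c : action G A) g :
  acts_by_automorphisms c -> g \in G ->
  exists f : {lrmorphism A -> A}, forall x, c x g = f x.
Proof.
by move=> autc Gg; have [lin mul] := autc g Gg;
  exists (algebra_morphism lin mul).
Qed.

(* [actMin], [actKin] and [actKVin] of the library assume a finite carrier. *)
Lemma act_mul (T : Type) (c : action G T) x :
  {in G &, forall g h, c x (g * h)%g = c (c x g) h}.
Proof. by case: c => ? []. Qed.

Lemma act_one (T : Type) (c : action G T) x : c x 1%g = x.
Proof.
have injc : left_injective c by case: c => ? [].
by apply: (injc 1%g); rewrite /= -act_mul ?mulg1.
Qed.

Lemma act_mulVK (T : Type) (c : action G T) x g :
  g \in G -> c (c x g^-1%g) g = x.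
Proof. by move=> Gg; rewrite -act_mul ?groupV // mulVg act_one. Qed.

Lemma act_mulK (T : Type) (c : action G T) x g :
  g \in G -> c (c x g) g^-1%g = x.
Proof. by move=> Gg; rewrite -act_mul ?groupV // mulgV act_one. Qed.

Variables (K : unitAlgType k) (c : action G K).
Hypothesis skewK : forall y : K, y != 0 -> y \is a GRing.unit.
Hypothesis char0 : forall m, m.+1%:R != 0 :> k.
Hypothesis autc : acts_by_automorphisms c.

Lemma natS_neq0 m : m.+1%:R != 0 :> K.
Proof. by rewrite -scaler_nat scaler_eq0 negb_or char0 oner_neq0. Qed.

Definition is_fixed : {pred K} := fun y => `[< {in G, forall g, c y g = y} >].

Lemma is_fixed_divalg_closed : divalg_closed is_fixed.
Proof.
split=> [|a x y /asboolP cx /asboolP cy|x y /asboolP cx /asboolP cy];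
  apply/asboolP => g Gg; have [f cE] := act_lrmorphism autc Gg; rewrite cE.
- exact: rmorph1.
- by rewrite linearP /= -!cE cx ?cy.
have [->|/skewK Uy] := eqVneq y 0; first by rewrite invr0 mulr0 rmorph0.
by rewrite rmorphM rmorphV //= -!cE cx ?cy.
Qed.

Definition fixed : divalgClosed K := divalg_pred is_fixed_divalg_closed.

Lemma fixedP y : reflect {in G, forall g, c y g = y} (y \in fixed).
Proof. exact: asboolP. Qed.

Definition trace y := \sum_(h in G) c y h.

Lemma trace_fixed y : trace y \in fixed.
Proof.
apply/fixedP => g Gg; have [f cE] := act_lrmorphism autc Gg.
rewrite /trace cE rmorph_sum [RHS](reindex_inj (mulIg g)) /=.
apply: eq_big => [h|h Gh]; first by rewrite groupMr.
by rewrite -cE act_mul.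
Qed.

Lemma trace_sum_fixed r (b q : 'I_r -> K) : (forall i, q i \in fixed) ->
  trace (\sum_i b i * q i) = \sum_i trace (b i) * q i.
Proof.
move=> /(_ _)/fixedP fq; rewrite /trace.
under [RHS]eq_bigr => i _ do rewrite mulr_suml.
rewrite exchange_big; apply: eq_bigr => h Gh /=.
have [f cE] := act_lrmorphism autc Gh; rewrite cE rmorph_sum.
by apply: eq_bigr => i _; rewrite rmorphM /= -!cE fq.
Qed.

Lemma fixed_trace y : y \in fixed -> trace y = #|G|%:R * y.
Proof.
move=> /fixedP fy; rewrite /trace (eq_bigr (fun=> y)) => [|h Gh];
  last exact: fy.
by rewrite sumr_const mulr_natl.
Qed.

Lemma card_group_neq0 : #|G|%:R != 0 :> K.
Proof. by rewrite -(prednK (cardG_gt0 G)) natS_neq0. Qed.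

Variable M : divalgClosed K.
Hypothesis stabM : forall g y, g \in G -> y \in M -> c y g \in M.

Lemma fixedI_divalg_closed : divalg_closed [predI M & fixed].
Proof.
split=> [|a x y /andP[Mx fx] /andP[My fy]|x y /andP[Mx fx] /andP[My fy]].
- by rewrite inE !rpred1.
- by rewrite inE !rpredD ?rpredZ.
- by rewrite inE !rpred_div.
Qed.

Definition fixedM : divalgClosed K := divalg_pred fixedI_divalg_closed.

Lemma fixedME y : (y \in fixedM) = (y \in M) && (y \in fixed).
Proof. by []. Qed.

Lemma trace_fixedM y : y \in M -> trace y \in fixedM.
Proof.
by move=> My; rewrite fixedME trace_fixed rpred_sum // => h Gh; apply: stabM.
Qed.

(* Artin: a solution over M of the system sum_j g(b_j) z_j = 0 (g in G),
   normalized so that some z_j = 1, has a nonzero trace, which is again a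
   solution. *)
Lemma artin_dependent m (b : 'I_m -> K) : (#|G| < m)%N ->
  (forall j, b j \in M) ->
  exists z : 'I_m -> K, [/\ forall j, z j \in fixedM, exists j, z j != 0
    & \sum_j b j * z j = 0].
Proof.
move=> ltGm Mb; have [|z [Mz [j0 nz0] eqz]] :=
  skew_solve (Q := M) (A := fun (i : 'I_#|G|) j => c (b j) (enum_val i)) skewK
    ltGm.
  by move=> i j; rewrite stabM ?enum_valP.
pose w j := z j / z j0; have Mw j : w j \in M by rewrite rpred_div.
exists (fun j => trace (w j)); split=> [j||]; first exact: trace_fixedM.
  exists j0; rewrite /w divrr ?skewK //.
  by rewrite fixed_trace ?rpred1 // mulr1 card_group_neq0.
under eq_bigr => j _ do rewrite mulr_sumr.
rewrite exchange_big big1 //= => h Gh.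
have [f cE] := act_lrmorphism autc Gh; have GhV := groupVr Gh.
(* The summand at [h] is the image under [h] of the equation of index [h^-1], because [h] sends the
   coefficient [c (b j) h^-1] back to [b j]. *)
transitivity (f (\sum_j c (b j) h^-1%g * w j)).
  rewrite rmorph_sum; apply: eq_bigr => j _.
  by rewrite rmorphM /= -!cE act_mulVK.
under eq_bigr => j _ do rewrite /w mulrA.
have := eqz (enum_rank_in Gh h^-1%g); rewrite enum_rankK_in // => eq0.
by rewrite -mulr_suml eq0 mul0r rmorph0.
Qed.

Let independent r := `[< exists b : 'I_r -> K, (forall i, b i \in M) /\
  forall z : 'I_r -> K, (forall j, z j \in fixedM) -> \sum_j b j * z j = 0 ->
    forall j, z j = 0 >].

(** A family independent over the fixed field has at most [#|G|] members by [artin_dependent]. One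
    of maximal length spans, since an element outside its span could be adjoined to it. *)
Lemma artin_basis :
  exists r (b : 'I_r -> K), (forall i, b i \in M) /\
    forall y, y \in M -> rspan fixedM b y.
Proof.
have ex_ind : exists r, independent r.
  by exists 0%N; apply/asboolP; exists (fun=> 0); split=> [|z _ _] [].
have ub_ind r : independent r -> (r <= #|G|)%N.
  move/asboolP=> [b [Mb indb]]; rewrite leqNgt; apply/negP => ltGr.
  have [z [fz [j nz] eqz]] := artin_dependent ltGr Mb.
  by rewrite indb ?eqxx in nz.
case: (ex_maxnP ex_ind ub_ind) => r /asboolP[b [Mb indb]] maxr.
exists r, b; split=> // y My; apply: contrapT => nspan.
suff /maxr : independent r.+1 by rewrite ltnn.
apply/asboolP; exists (fun j => if unlift ord0 j is Some i then b i else y).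
split=> [j|z fz]; first by case: unliftP.
rewrite big_ord_recl unlift_none; under eq_bigr => i _ do rewrite liftK.
move=> eqz; have z00 : z ord0 = 0.
  apply: contra_notP nspan => /eqP/skewK Uz.
  exists (fun i => - (z (lift ord0 i) / z ord0)).
  split=> [i|]; first by rewrite rpredN rpred_div.
  move/eqP: eqz; rewrite addr_eq0 => /eqP eqz.
  rewrite -[y in LHS](mulrK Uz) eqz mulNr mulr_suml -sumrN.
  by apply: eq_bigr => i _; rewrite mulrN mulrA.
move=> j; case: (unliftP ord0 j) => [i ->|-> //].
rewrite z00 mulr0 add0r in eqz.
exact: (indb (fun i => z (lift ord0 i))).
Qed.

Hypothesis commM : {in M &, commutative *%R}.

(* A relation of minimal length between the powers of y over the fixed field is
   killed by [P, _], which gives a shorter one unless [P, y] = 0. *)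
Lemma ad_fixed_ad0 P : (forall y, y \in M -> ad P y \in M) ->
  (forall y, y \in fixedM -> ad P y = 0) -> forall y, y \in M -> ad P y = 0.
Proof.
move=> adPM adPf y My; apply/eqP; apply: contraT => nz.
pose rel m := `[< exists z : 'I_m -> K, [/\ forall j, z j \in fixedM,
  exists j, z j != 0 & \sum_(j < m) y ^+ j * z j = 0] >].
have exrel : exists m, rel m.
  exists #|G|.+1; apply/asboolP.
  by apply: (artin_dependent (b := fun j => y ^+ j)) => // j; rewrite rpredX.
case: (ex_minnP exrel) => m /asboolP[z [fz [j nzj] eqz]] minm.
case: m z fz j nzj eqz minm => [z _ []//|m] z fz j nzj eqz minm.
have fMP x : x \in fixedM -> x \in M by rewrite fixedME => /andP[].
(* Bracketing the relation with [P] gives sum (i+1) y^i [P, y] z_(i+1) = 0. As [P, y] is nonzero and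
   commutes with [y], it cancels and leaves a relation with one term less, which minimality forbids
   unless all these coefficients vanish. *)
have zS i : z (lift ord0 i) = 0.
  apply: contraTeq isT => nzi.
  suff /minm : rel m by rewrite ltnn.
  apply/asboolP; exists (fun i : 'I_m => z (lift ord0 i) *+ i.+1).
  split=> [i'||]; first by rewrite rpredMn.
    exists i; rewrite -mulr_natr; apply: contra_neq nzi => /skew_mulf_eq0 nz0.
    apply: contraTeq isT => /(nz0 skewK)/eqP; by rewrite (negPf (natS_neq0 _)).
  have cy : GRing.comm y (ad P y) by apply: commM; rewrite ?adPM.
  have : ad P (\sum_(j < m.+1) y ^+ j * z j) = 0.
    by rewrite eqz /ad mulr0 mul0r subrr.
  rewrite ad_sum big_ord_recl adMr (adPf _ (fz _)) expr0.
  rewrite [ad P 1]ad_comm ?mul0r ?mulr0 ?addr0 ?add0r; last first.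
    exact: commr1.
  under eq_bigr => i' _ do
    rewrite adMr (adPf _ (fz _)) mulr0 addr0 lift0 (adX _ cy) mulrnAl -mulrA.
  move=> eq0; apply: (skew_mulf_eq0 skewK (x := ad P y)) => //.
  rewrite mulr_sumr -[RHS]eq0; apply: eq_bigr => i' _.
  rewrite !mulrnAr; congr (_ *+ _).
  by rewrite !mulrA; congr (_ * _); apply: commM; rewrite ?adPM ?rpredX.
have z0 : z ord0 = 0.
  move: eqz; rewrite big_ord_recl expr0 mul1r big1 ?addr0 // => i _.
  by rewrite zS mulr0.
by case: (unliftP ord0 j) nzj => [i ->|->]; rewrite ?zS ?z0 eqxx.
Qed.

End GroupAction.

(** * Extension of morphisms to skew fields of fractions *)

Section FractionExtension.
Variables (k : fieldType) (A : algType k) (K F : unitAlgType k).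
Variables (iota : {lrmorphism A -> K}) (phi : {lrmorphism A -> F}).
Hypothesis fracK : is_skew_fraction_field iota.
Hypothesis skewF : forall y : F, y != 0 -> y \is a GRing.unit.
Hypothesis phi_inj : injective phi.

Let iotaU (s : A) : s != 0 -> iota s \is a GRing.unit.
Proof. by case: fracK => skewK injK _ nzs; apply: skewK; rewrite raddf_eq0. Qed.

Let phiU (s : A) : s != 0 -> phi s \is a GRing.unit.
Proof. by move=> nzs; apply: skewF; rewrite raddf_eq0. Qed.

Let fracM_neq0 (s t : A) : s != 0 -> t != 0 -> s * t != 0.
Proof.
have [skewK injK _] := fracK => nzs; apply: contra_neq => st0; apply: injK.
rewrite rmorph0; apply: (skew_mulf_eq0 skewK (x := iota s)).
  by rewrite -rmorphM st0 rmorph0.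
by apply: contraTneq (iotaU nzs) => ->; rewrite unitr0.
Qed.

(** The Ore condition comes from the field of fractions itself: the left fraction s^-1 a is also a
    right fraction p q^-1. *)
Lemma right_ore (a s : A) : s != 0 -> exists p q, q != 0 /\ s * p = a * q.
Proof.
have [_ injK fracE] := fracK => nzs.
have [p [q [nzq pq]]] := fracE ((iota s)^-1 * iota a).
exists p, q; split=> //; apply: injK; rewrite !rmorphM /=.
rewrite -[iota p](divrK (iotaU nzq)) -pq !mulrA divrr ?mul1r //.
exact: iotaU.
Qed.

Lemma frac_expand (a s p : A) : s != 0 -> p != 0 ->
  iota a / iota s = iota (a * p) / iota (s * p).
Proof.
move=> nzs nzp; rewrite !rmorphM /= invrM ?iotaU //.
by rewrite mulrA mulrK ?iotaU.
Qed.

Lemma common_denominator x y : exists a b w,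
  [/\ w != 0, x = iota a / iota w & y = iota b / iota w].
Proof.
have [_ _ fracE] := fracK; have [a [s [nzs ->]]] := fracE x.
have [b [t [nzt ->]]] := fracE y; have [p [q [nzq spq]]] := right_ore t nzs.
have nzp : p != 0.
  by apply: contraNneq (fracM_neq0 nzt nzq) => p0; rewrite -spq p0 mulr0.
exists (a * p), (b * q), (s * p); split; first exact: fracM_neq0.
  exact: frac_expand.
by rewrite spq; apply: frac_expand.
Qed.

(** The map is defined through a chosen numerator and denominator. [PhiE] compares two
    representations of one element over a common denominator given by the Ore condition; afterwards
    each property is checked on convenient representatives. *)
Lemma extension_exists : exists Phi : {lrmorphism K -> F},
  injective Phi /\ forall a, Phi (iota a) = phi a.
Proof.
have [skewK injK fracE] := fracK.
have /choice[r rE] : forall y, exists r : A * A,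
    r.2 != 0 /\ y = iota r.1 / iota r.2.
  by move=> y; have [a [s ?]] := fracE y; exists (a, s).
pose Phi y := phi (r y).1 / phi (r y).2.
have PhiE a s : s != 0 -> Phi (iota a / iota s) = phi a / phi s.
  move=> nzs; rewrite /Phi; set y := iota a / _; have [nzr yE] := rE y.
  move: (r y).1 (r y).2 => a' s' in nzr yE *.
  have [p [q [nzq spq]]] := right_ore s' nzs.
  have nzp : p != 0.
    by apply: contraNneq (fracM_neq0 nzr nzq) => p0; rewrite -spq p0 mulr0.
  have apq : a * p = a' * q.
    apply: injK; rewrite !rmorphM /= -[iota a](divrK (iotaU nzs)) -/y {1}yE.
    by rewrite -mulrA -rmorphM spq rmorphM !mulrA divrK ?iotaU.
  rewrite -[phi a'](mulrK (phiU nzq)) -rmorphM -apq -mulrA -invrM ?phiU //.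
  by rewrite -rmorphM -spq !rmorphM /= invrM ?phiU // mulrA mulrK ?phiU.
have Phi_iota a : Phi (iota a) = phi a.
  have := @PhiE a 1 (oner_neq0 _).
  by rewrite !rmorph1 !divr1.
have Phi_lin : linear Phi.
  move=> c x y; have [a [b [w [nzw -> ->]]]] := common_denominator x y.
  by rewrite scalerAl -mulrDl -linearP !PhiE //= linearP mulrDl scalerAl.
have Phi_mul : monoid_morphism Phi.
  split=> [|x y]; first by rewrite -(rmorph1 iota) Phi_iota rmorph1.
  have [a [s [nzs ->]]] := fracE x; have [b [t [nzt ->]]] := fracE y.
  have [p [q [nzq spq]]] := right_ore b nzs.
  have -> : iota a / iota s * (iota b / iota t) = iota (a * p) / iota (t * q).
    have -> : iota b = iota s * iota p / iota q.
      by rewrite -rmorphM spq rmorphM /= mulrK ?iotaU.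
    by rewrite !rmorphM /= invrM ?iotaU // !mulrA mulrVK ?iotaU.
  rewrite !PhiE ?fracM_neq0 //.
  have -> : phi b = phi s * phi p / phi q.
    by rewrite -rmorphM spq rmorphM /= mulrK ?phiU.
  by rewrite !rmorphM /= invrM ?phiU // !mulrA mulrVK ?phiU.
exists (algebra_morphism Phi_lin Phi_mul); split=> //= x y eqPhi.
(* A nonzero difference would be a unit, and its image 0 would be a unit too. *)
apply/eqP; rewrite -subr_eq0; apply: contraTT isT => /skewK Uz.
have := rmorph_unit (algebra_morphism Phi_lin Phi_mul) Uz.
by rewrite rmorphB /= eqPhi subrr unitr0.
Qed.

Lemma extension_unique (f g : {lrmorphism K -> F}) :
  (forall a, f (iota a) = g (iota a)) -> f =1 g.
Proof.
have [_ _ fracE] := fracK => fg y; have [a [s [nzs ->]]] := fracE y.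
by rewrite !rmorphM /= !rmorphV ?iotaU //= !fg.
Qed.

End FractionExtension.

(** * The Weyl algebra *)

Section WeylMap.
Variables (k : fieldType) (n : nat) (B : algType k) (y d : 'I_n -> B).
Hypotheses (yy : forall i j, y i * y j = y j * y i)
  (dd : forall i j, d i * d j = d j * d i)
  (dy : forall i j, d i * y j = y j * d i + (i == j)%:R%:A).

Fixpoint weyl_eval (s : weyl_term k n) : B :=
  match s with
  | WX i => y i
  | WD i => d i
  | WConst c => c%:A
  | WAdd s t => weyl_eval s + weyl_eval t
  | WMul s t => weyl_eval s * weyl_eval t
  end.

Lemma weyl_eval_eq s t : weyl_eq s t -> weyl_eval s = weyl_eval t.
Proof.
elim=> {s t} //=.
- by move=> t s u _ -> _ ->.
- by move=> s s' t t' _ -> _ ->.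
- by move=> s s' t t' _ -> _ ->.
- by move=> s t u; rewrite addrA.
- by move=> s t; rewrite addrC.
- by move=> s; rewrite scale0r add0r.
- by move=> s t u; rewrite mulrA.
- by move=> s; rewrite scale1r mul1r.
- by move=> s; rewrite scale0r mul0r.
- by move=> s t u; rewrite mulrDl.
- by move=> s t u; rewrite mulrDr.
- by move=> a b; rewrite scalerDl.
- by move=> a b; rewrite -scalerAl mul1r scalerA.
- by move=> a s; rewrite -scalerAl mul1r -scalerAr mulr1.
Qed.

Lemma weyl_map_exists : exists f : {lrmorphism weyl k n -> B},
  (forall i, f (weyl_pi (WX k i)) = y i) /\
  (forall i, f (weyl_pi (WD k i)) = d i).
Proof.
pose f (u : weyl k n) := weyl_eval (generic_quotient.repr u).
have fE s : f (weyl_pi s) = weyl_eval s by apply/weyl_eval_eq/weyl_repr.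
have f_lin : linear f.
  move=> c u v; elim/weyl_ind: u => s; elim/weyl_ind: v => t.
  rewrite /GRing.scale /GRing.add /= weyl_scaleqE weyl_addqE !fE /=.
  by rewrite -scalerAl mul1r.
have f_mul : monoid_morphism f.
  split=> [|u v]; first by rewrite /GRing.one /= fE /= scale1r.
  elim/weyl_ind: u => s; elim/weyl_ind: v => t.
  by rewrite {1}/GRing.mul /= weyl_mulqE !fE.
by exists (algebra_morphism f_lin f_mul); split=> i; apply: fE.
Qed.

End WeylMap.

(** * Ordered polynomials in elements with scalar brackets *)

Section OrderedMonomials.
Variables (k : fieldType) (B : algType k).
Implicit Types e : B.

Lemma ad_exp e x (a : k) m : ad e x = a%:A ->
  ad e (x ^+ m) = (m%:R * a) *: x ^+ m.-1.
Proof.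
case: m => [|m] eE; first by rewrite mul0r scale0r ad_comm //; apply: commr1.
rewrite adX ?eE; last by rewrite /GRing.comm -scalerAr mulr1 -scalerAl mul1r.
by rewrite -scalerAr mulr1 -scaler_nat scalerA.
Qed.

(** The brackets of [e] with the [h j] are scalars, hence central, so the Leibniz rule works factor
    by factor although the [h j] need not commute. If [m j0] is 0, the truncated exponent is
    multiplied by the scalar 0. *)
Lemma ad_ordered_prod (N : nat) (h : 'I_N -> B) e j0 (m : 'X_{1..N}) s :
  (forall j, ad e (h j) = (j == j0)%:R%:A) -> uniq s ->
  ad e (\prod_(j <- s) h j ^+ m j) =
    (if j0 \in s then (m j0)%:R else 0) *:
      \prod_(j <- s) h j ^+ (m - U_(j0))%MM j.
Proof.
move=> eh; elim: s => [_|j s IHs] /=.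
  by rewrite !big_nil scale0r ad_comm //; apply: commr1.
move=> /andP[js us]; rewrite !big_cons adMr {}IHs // inE.
rewrite (ad_exp _ (eh j)); have [<-|neq] /= := eqVneq j j0.
  rewrite (negPf js) scale0r mulr0 addr0 /= mulr1 -scalerAl mnmBE mnm1E eqxx.
  rewrite subn1; congr (_ *: (_ * _)); apply: eq_big_seq => i si.
  rewrite mnmBE mnm1E; case: eqVneq => [ij|_]; last by rewrite subn0.
  by rewrite ij si in js.
rewrite mulr0 scale0r mul0r add0r /= -scalerAr.
by rewrite mnmBE mnm1E eq_sym (negPf neq) subn0.
Qed.

Lemma ad_mmap (N : nat) (h : 'I_N -> B) e j0 (P : {mpoly k[N]}) :
  (forall j, ad e (h j) = (j == j0)%:R%:A) ->
  ad e (mmap (in_alg B) h P) = mmap (in_alg B) h P^`M(j0).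
Proof.
move=> eh; elim/mpolyind: P => [|c m P _ _ IHP].
  by rewrite mderiv0 !mmap0 ad_comm //; apply: commr0.
rewrite linearP /= !mmapD adD IHP; congr (_ + _).
rewrite !mmapZ mderivX mmapZ !mmapX /= -!scalerAl !mul1r.
have adZ x : ad e (c *: x) = c *: ad e x.
  by rewrite /ad -scalerAr -scalerAl scalerBr.
rewrite adZ /mmap1 (ad_ordered_prod _ eh) ?index_enum_uniq //.
by rewrite mem_index_enum.
Qed.

Hypothesis char0 : forall m, m.+1%:R != 0 :> k.

(* The commutators with the e_i act on ordered polynomials in the h_i as partial
   derivatives, which reduce a nonzero polynomial to a nonzero constant. *)
Lemma mmap_dual_inj (N : nat) (h e : 'I_N -> B) (P : {mpoly k[N]}) :
  (forall i j, ad (e i) (h j) = (j == i)%:R%:A) ->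
  mmap (in_alg B) h P = 0 -> P = 0.
Proof.
move=> eh; have [m] := ubnP (msize P); elim: m P => // m IHm P ltPm P0.
have dP0 i : P^`M(i) = 0.
  have [-> | nzP] := eqVneq P 0; first by rewrite raddf0.
  apply: IHm; last first.
    by rewrite -(ad_mmap P (eh i)) P0 ad_comm //; apply: commr0.
  rewrite ltnS in ltPm; apply: leq_trans ltPm.
  rewrite (msizeE P^`M(i)) big_seq; elim/big_ind: _ => [|u v|m' m'P].
  - by rewrite lt0n msize_poly_eq0.
  - by move=> uP vP; rewrite gtn_max uP.
  have : (m' + U_(i))%MM \in msupp P.
    move: m'P; rewrite !mcoeff_msupp mcoeff_mderiv.
    by apply: contra_neq => ->; rewrite mul0rn.
  by move/msize_mdeg_lt; rewrite mdegD mdeg1 addn1.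
have PE : P = (P@_0%MM)%:MP.
  apply/mpolyP => m'; rewrite mcoeffC; have [->|nz] := eqVneq m' 0%MM.
    by rewrite mulr1.
  have /existsP[i nzi] : [exists i, m' i != 0%N].
    apply: contraNT nz => /existsPn m0; apply/eqP/mnmP => i.
    by rewrite mnm0E; apply/eqP/negPn/m0.
  have := congr1 (mcoeff (m' - U_(i))) (dP0 i).
  rewrite mcoeff_mderiv mcoeff0 submK; last by rewrite lep1mP.
  rewrite mulr0 -mulr_natr => /eqP.
  by rewrite mulf_eq0 (negPf (char0 _)) orbF => /eqP.
move: P0; rewrite PE mmapC /= => /eqP.
by rewrite scaler_eq0 oner_eq0 orbF => /eqP ->; rewrite mpolyC0.
Qed.

End OrderedMonomials.

(** * Normal forms and injectivity for the Weyl algebra *)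

Section WeylNormalForm.
Variables (k : fieldType) (n : nat).
Hypothesis char0 : forall m, m.+1%:R != 0 :> k.
Local Notation W := (weyl k n).

Definition wx i : W := weyl_pi (WX k i).
Definition wd i : W := weyl_pi (WD k i).

Lemma wxC i j : wx i * wx j = wx j * wx i.
Proof. by rewrite /GRing.mul /= !weyl_mulqE; apply/weyl_piP/weyl_XX. Qed.

Lemma wdC i j : wd i * wd j = wd j * wd i.
Proof. by rewrite /GRing.mul /= !weyl_mulqE; apply/weyl_piP/weyl_DD. Qed.

Lemma weyl_constE (c : k) : weyl_pi (WConst n c) = c%:A :> W.
Proof.
rewrite /GRing.scale /GRing.one /= weyl_scaleqE; apply/weyl_piP.
exact: weyl_trans (weyl_sym (weyl_mul1 _)) (weyl_sym (weyl_constC _ _)).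
Qed.

Lemma ad_wd_wx i j : ad (wd i) (wx j) = (i == j)%:R%:A.
Proof.
apply/eqP; rewrite subr_eq addrC -weyl_constE; apply/eqP.
rewrite /GRing.mul /GRing.add /= !weyl_mulqE weyl_addqE.
exact/weyl_piP/weyl_DX.
Qed.

Definition wgen (j : 'I_(n + n)) : W :=
  match fintype.split j with inl i => wx i | inr i => wd i end.

(** Since [d_i, x_i] = 1 = [-x_i, d_i], bracketing with these elements is differentiation with
    respect to the generators [wgen]. They are taken in the image of [f], where injectivity has to
    be tested. *)
Definition wgen_dual (B : algType k) (f : {lrmorphism W -> B}) (j : 'I_(n + n))
  :=
  match fintype.split j with inl i => f (wd i) | inr i => - f (wx i) end.

Lemma ad_wgen_dual (B : algType k) (f : {lrmorphism W -> B}) i j :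
  ad (wgen_dual f i) (f (wgen j)) = (j == i)%:R%:A.
Proof.
have adN (x y : B) : ad (- x) y = ad y x by rewrite /ad mulNr mulrN opprK addrC.
rewrite /wgen_dual /wgen; case: (splitP i) => i' iE; case: (splitP j) => j' jE.
- rewrite -rmorph_ad ad_wd_wx /= linearZ /= rmorph1; congr (_%:R%:A).
  congr nat_of_bool; apply/eqP/eqP => ij; apply: val_inj.
    by rewrite /= iE jE ij.
  by rewrite /= -iE -jE ij.
- rewrite -rmorph_ad ad_comm ?raddf0 ?wdC //; last exact: wdC.
  have [/(congr1 val)/=|_] := eqVneq j i; last by rewrite scale0r.
  by rewrite iE jE => ji; move: (ltn_ord i'); rewrite -ji ltnNge leq_addr.
- rewrite adN -rmorph_ad ad_comm ?raddf0; last exact: wxC.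
  have [/(congr1 val)/=|_] := eqVneq j i; last by rewrite scale0r.
  by rewrite iE jE => ji; move: (ltn_ord j'); rewrite ji ltnNge leq_addr.
rewrite adN -rmorph_ad ad_wd_wx /= linearZ /= rmorph1; congr (_%:R%:A).
congr nat_of_bool; apply/eqP/eqP => ij; apply: val_inj.
  by rewrite /= iE jE ij.
by apply: (@addnI n); rewrite /= -iE -jE ij.
Qed.

Lemma commuting_prod (B : nzRingType) (I : eqType) (h : I -> B) (m : I -> nat) i
  s :
  (forall i j, h i * h j = h j * h i) -> i \in s -> uniq s ->
  h i * \prod_(j <- s) h j ^+ m j = \prod_(j <- s) h j ^+ (m j + (i == j)).
Proof.
move=> hC; elim: s => //= j s IHs; rewrite inE !big_cons => si /andP[js us].
case: (eqVneq i j) si => [-> _|neq /= si].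
  rewrite mulrA -exprS addn1; congr (_ * _); apply: eq_big_seq => l ls.
  by case: eqVneq ls => [<-|_ _]; rewrite ?(negPf js) ?addn0.
by rewrite addn0 -IHs // !mulrA; congr (_ * _); apply: commrX; apply: hC.
Qed.

(** [mmap] multiplies in the order of the indices, so a polynomial in 2n variables becomes a
    combination of monomials with every x_i to the left of every d_i. *)
Let nf := mmap (in_alg W) wgen.

Let nfX (m : 'X_{1..n + n}) : mmap1 wgen m =
  \prod_(i < n) wx i ^+ m (lshift n i) * \prod_(i < n) wd i ^+ m (rshift n i).
Proof.
rewrite /mmap1 big_split_ord; congr (_ * _); apply: eq_bigr => i _;
  rewrite /wgen.
  by case: splitP => j /= jE; [rewrite (val_inj jE) |
    move: (ltn_ord i); rewrite jE ltnNge leq_addr].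
case: splitP => j /= jE; last by rewrite (val_inj (addnI jE)).
by move: (ltn_ord j); rewrite -jE ltnNge leq_addr.
Qed.

Let nf_linear c P Q : nf (c *: P + Q) = c *: nf P + nf Q.
Proof. by rewrite /nf mmapD mmapZ /= -scalerAl mul1r. Qed.

Let nf_sum (T : {mpoly k[n + n]} -> W) (F : W -> W) :
  linear F -> (forall P m c, T (c *: 'X_[m] + P) = c *: T 'X_[m] + T P) -> T 0 =
    0 ->
  (forall m, F (nf 'X_[m]) = T 'X_[m]) -> forall P, F (nf P) = T P.
Proof.
move=> linF linT T0 FX; elim/mpolyind=> [|c m P _ _ IHP].
  rewrite T0 /nf mmap0.
  by have := linF (-1) 0 0; rewrite scaler0 addr0 scaleN1r addNr.
by rewrite nf_linear linF FX IHP linT.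
Qed.

Lemma wx_nf i P : wx i * nf P = nf ('X_(lshift n i) * P).
Proof.
apply: (nf_sum (T := fun P => nf ('X_(lshift n i) * P)) (F := fun u => wx i *
  u)).
- by move=> c u v; rewrite mulrDr -scalerAr.
- by move=> Q m c; rewrite mulrDr -scalerAr nf_linear.
- by rewrite mulr0 /nf mmap0.
move=> m; rewrite -mpolyXD /nf !mmapX !nfX mulrA.
rewrite (commuting_prod _ wxC) ?mem_index_enum ?index_enum_uniq //.
congr (_ * _); apply: eq_bigr => j _; rewrite mnmDE mnm1E addnC.
  by rewrite eq_lshift.
by rewrite eq_lrshift addn0.
Qed.

Lemma nf_wd i P : nf P * wd i = nf (P * 'X_(rshift n i)).
Proof.
apply: (nf_sum (T := fun P => nf (P * 'X_(rshift n i))) (F := fun u => u * wd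
  i)).
- by move=> c u v; rewrite mulrDl -scalerAl.
- by move=> Q m c; rewrite mulrDl -scalerAl nf_linear.
- by rewrite mul0r /nf mmap0.
move=> m; rewrite -mpolyXD /nf !mmapX !nfX -mulrA; congr (_ * _).
  by apply: eq_bigr => j _; rewrite mnmDE mnm1E eq_rlshift addn0.
set x := \prod_i _; have -> : x * wd i = wd i * x.
  rewrite /x; elim/big_ind: _ => [|u v uC vC|j _]; first by rewrite mulr1 mul1r.
    by rewrite -mulrA vC !mulrA uC.
  exact/esym/commrX/wdC.
rewrite (commuting_prod _ wdC) ?mem_index_enum ?index_enum_uniq //.
by apply: eq_bigr => j _; rewrite mnmDE mnm1E eq_rshift.
Qed.

Lemma weyl_nf u : exists P, u = nf P.
Proof.
suff nf_mul s P : exists Q, weyl_pi s * nf P = nf Q.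
  elim/weyl_ind: u => s; have [Q] := nf_mul s 1.
  by rewrite {1}/nf -mpolyC1 mmapC /= scale1r mulr1 => ->; exists Q.
elim: s P => [i|i|c|s IHs t IHt|s IHs t IHt] P.
- by exists ('X_(lshift n i) * P); apply: wx_nf.
(* d_i P = P d_i + [d_i, P]: the first term is again ordered, and the bracket is the derivative of
   the normal form with respect to x_i. *)
- exists (P * 'X_(rshift n i) + P^`M(lshift n i)).
  rewrite -[P * _]scale1r nf_linear scale1r -nf_wd.
  suff <- : ad (wd i) (nf P) = nf P^`M(lshift n i) by rewrite addrC subrK.
  apply: ad_mmap => j; rewrite -(ad_wgen_dual idfun (lshift n i) j) /wgen_dual.
  by case: splitP => l /= E; [rewrite (val_inj E) |
    move: (ltn_ord i); rewrite E ltnNge leq_addr].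
- by exists (c *: P); rewrite weyl_constE -scalerAl mul1r /nf mmapZ /= -scalerAl
    mul1r.
- have [[Qs eqs] [Qt eqt]] := (IHs P, IHt P); exists (Qs + Qt).
  rewrite -[Qs]scale1r nf_linear scale1r -eqs -eqt -mulrDl.
  by congr (_ * _); rewrite /GRing.add /= weyl_addqE.
have [Qt eqt] := IHt P; have [Q eqQ] := IHs Qt; exists Q.
by rewrite -eqQ -eqt mulrA; congr (_ * _); rewrite /GRing.mul /= weyl_mulqE.
Qed.

(** A substitute for the simplicity of the Weyl algebra in characteristic 0. The images of the
    generators still have scalar brackets with the dual elements, so no nonzero ordered polynomial
    in them vanishes. *)
Lemma weyl_morph_inj (B : algType k) (f : {lrmorphism W -> B}) : injective f.
Proof.
move=> u v eqf; apply/eqP; rewrite -subr_eq0; apply/eqP.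
have [P uvP] := weyl_nf (u - v); rewrite uvP.
suff -> : P = 0 by rewrite /nf mmap0.
apply: (mmap_dual_inj char0 (ad_wgen_dual f)).
transitivity (f (nf P)); last by rewrite -uvP rmorphB /= eqf subrr.
rewrite /nf /mmap rmorph_sum; apply: eq_bigr => m _.
rewrite rmorphM /= linearZ /= rmorph1; congr (_ * _).
by rewrite /mmap1 rmorph_prod; apply: eq_bigr => j _; rewrite rmorphXn.
Qed.

End WeylNormalForm.

Definition subalg_pred (k : pzRingType) (A : lalgType k) (S : {pred A})
    (clS : subalg_closed S) : subalgClosed A :=
  HB.pack S (GRing.isSubalgClosed.Build k A S (GRing.subalg_closed_semi clS)).

(** Expresses inside the algebra that [S] is cut out by a subfield of its field of fractions: [S]
    contains every quotient of its elements that exists in the algebra. *)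
Definition division_closed (A : nzRingType) (S : {pred A}) :=
  forall q f, q != 0 -> q \in S -> q * f \in S -> f \in S.

(** * Laurent polynomials and their derivations *)

Section LaurentTheory.
Variables (k : fieldType) (n : nat).
Local Notation L := (laurent k n).

Definition lpoly (p : {mpoly k[n]}) : L := Laurent (is_laurent_poly p).

Lemma lpoly_linear : linear lpoly.
Proof.
move=> c p q; apply: val_inj => /=.
by rewrite -mul_mpolyC tofracD tofracM.
Qed.

Lemma lpoly_mul : monoid_morphism lpoly.
Proof.
by split=> [|p q]; apply: val_inj => /=; rewrite ?tofrac1 ?tofracM.
Qed.

HB.instance Definition _ :=
  GRing.isLinear.Build k {mpoly k[n]} L *:%R lpoly lpoly_linear.
HB.instance Definition _ :=
  GRing.isMonoidMorphism.Build {mpoly k[n]} L lpoly lpoly_mul.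

Lemma lpoly_inj : injective lpoly.
Proof. by move=> p q /(congr1 val) /= /eqP; rewrite tofrac_eq => /eqP. Qed.

Lemma laurent_mulf_eq0 (f g : L) : f * g = 0 -> f != 0 -> g = 0.
Proof.
move/(congr1 val)/eqP; rewrite /= mulf_eq0 => /orP[]/eqP v0 nz.
  by case/eqP: nz; apply: val_inj.
exact: val_inj.
Qed.

Lemma lX_mulV i : lX k i * lXV k i = 1 :> L.
Proof. by apply: val_inj; rewrite /= divff // tofracX_neq0. Qed.

Definition lmonV (m : 'X_{1..n}) : L := \prod_i lXV k i ^+ m i.

Lemma lmonV0 : lmonV 0%MM = 1.
Proof. by rewrite /lmonV big1 // => i _; rewrite mnm0E. Qed.

Lemma lmonVD m1 m2 : lmonV (m1 + m2)%MM = lmonV m1 * lmonV m2.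
Proof.
by rewrite /lmonV -big_split; apply: eq_bigr => i _; rewrite mnmDE exprD.
Qed.

Lemma lpolyX m : lpoly 'X_[m] = \prod_i lX k i ^+ m i.
Proof. by rewrite mpolyXE_id rmorph_prod; apply: eq_bigr => i _;
  rewrite rmorphXn. Qed.

Lemma lpolyX_mulV m : lpoly 'X_[m] * lmonV m = 1.
Proof.
rewrite lpolyX -big_split big1 //= => i _.
by rewrite -exprMn lX_mulV expr1n.
Qed.

Lemma laurent_fracE f : exists p m, f = lpoly p * lmonV m.
Proof.
case: f => f lf; have /asboolP[p [m fE]] := lf; exists p, m.
rewrite -[LHS]mulr1 -(lpolyX_mulV m) mulrA; congr (_ * _).
by apply: val_inj; rewrite /= fE divfK // tofracX_neq0.
Qed.

Lemma lfrac_eq p q m r : lpoly p * lmonV m = lpoly q * lmonV r ->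
  p * 'X_[r] = q * 'X_[m].
Proof.
move/(congr1 ( *%R^~ (lpoly 'X_[m] * lpoly 'X_[r]))).
rewrite mulrA [X in _ = X]mulrACA -!mulrA (mulrA (lmonV m)).
rewrite (mulrC (lmonV m)) (mulrC (lmonV r)) !lpolyX_mulV mul1r mulr1.
by rewrite -!rmorphM => /lpoly_inj.
Qed.

Lemma lfrac_expand p m r :
  lpoly p * lmonV m = lpoly (p * 'X_[r]) * lmonV (m + r)%MM.
Proof. by rewrite lmonVD rmorphM mulrACA lpolyX_mulV mulr1. Qed.

Lemma laurent_common f g : exists p q m,
  f = lpoly p * lmonV m /\ g = lpoly q * lmonV m.
Proof.
have [p [m ->]] := laurent_fracE f; have [q [r ->]] := laurent_fracE g.
exists (p * 'X_[r]), (q * 'X_[m]), (m + r)%MM.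
by split; [|rewrite addmC]; apply: lfrac_expand.
Qed.

Lemma laurent_ind (P : L -> Prop) :
  P 1 -> (forall c f g, P f -> P g -> P (c *: f + g)) ->
  (forall f g, P f -> P g -> P (f * g)) ->
  (forall i, P (lX k i)) -> (forall i, P (lXV k i)) -> forall f, P f.
Proof.
move=> P1 PD PM PX PV f; have [p [m ->]] := laurent_fracE f.
have P0 : P 0 by rewrite -(addNr 1) -scaleN1r; apply: PD.
have Pexp g j : P g -> P (g ^+ j).
  by move=> Pg; elim: j => [|j IHj]; rewrite ?expr0 ?exprS //; apply: PM.
have Pmon h (r : 'X_{1..n}) : (forall i, P (h i)) -> P (\prod_i h i ^+ r i).
  by move=> Ph; elim/big_ind: _ => // i _; apply: Pexp.
apply: PM; last exact: Pmon.
elim/mpolyind: p => [|c r p _ _ IHp]; first by rewrite raddf0.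
rewrite linearP; apply: PD => //=; rewrite lpolyX.
exact: Pmon.
Qed.

Section Morphism.
Variables (B : comAlgType k) (t tV : 'I_n -> B).
Hypothesis t_mulV : forall i, t i * tV i = 1.

Lemma laurent_morph_exists : exists f : {lrmorphism L -> B},
  (forall i, f (lX k i) = t i) /\ (forall i, f (lXV k i) = tV i).
Proof.
pose ev := mmap (in_alg B) t; pose mV (m : 'X_{1..n}) := \prod_i tV i ^+ m i.
have evX m : ev 'X_[m] * mV m = 1.
  rewrite /ev mmapX /mmap1 /mV -big_split big1 //= => i _.
  by rewrite -exprMn t_mulV expr1n.
have mVD m r : mV (m + r)%MM = mV m * mV r.
  by rewrite /mV -big_split; apply: eq_bigr => i _; rewrite mnmDE exprD.
have /choice[r rE] : forall f : L, exists r : {mpoly k[n]} * 'X_{1..n},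
    f = lpoly r.1 * lmonV r.2.
  by move=> f; have [p [m fE]] := laurent_fracE f; exists (p, m).
pose h f := ev (r f).1 * mV (r f).2.
have hE p m : h (lpoly p * lmonV m) = ev p * mV m.
  have := rE (lpoly p * lmonV m); rewrite /h; case: (r _) => q s /= /lfrac_eq.
  move/(congr1 ev); rewrite /ev !rmorphM /= -/(ev _) => pq.
  rewrite -[LHS]mulr1 -(evX m) -[RHS]mulr1 -(evX s) mulrACA [RHS]mulrACA.
  by rewrite /ev -pq [mV m * _]mulrC.
have hpoly p : h (lpoly p) = ev p.
  have := hE p 0%MM; rewrite lmonV0 mulr1 => ->.
  by rewrite /mV big1 ?mulr1 // => i _; rewrite mnm0E.
have h_lin : linear h.
  move=> c f g; have [p [q [m [-> ->]]]] := laurent_common f g.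
  rewrite scalerAl -mulrDl -linearP !hE /ev mmapD mmapZ /= mulrDl.
  by rewrite -scalerAl mul1r scalerAl.
have h_mul : monoid_morphism h.
  split=> [|f g].
    by rewrite -(rmorph1 lpoly) hpoly /ev rmorph1.
  have [p [m ->]] := laurent_fracE f; have [q [s ->]] := laurent_fracE g.
  by rewrite mulrACA -rmorphM -lmonVD !hE /ev rmorphM mVD mulrACA.
exists (algebra_morphism h_lin h_mul); split=> i /=.
  by rewrite -[lX k i]/(lpoly 'X_i) hpoly /ev mmapX mmap1U.
have -> : lXV k i = lpoly 1 * lmonV U_(i)%MM.
  by rewrite rmorph1 mul1r; apply: esym (mmap1U _ i).
by rewrite hE /ev rmorph1 mul1r; apply: mmap1U.
Qed.

End Morphism.

Lemma laurent_morph_eq (B : comAlgType k) (f g : {lrmorphism L -> B}) :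
  (forall i, f (lX k i) = g (lX k i)) -> f =1 g.
Proof.
move=> eqX; apply: laurent_ind => [|c u v fu fv|u v fu fv|//|i].
- by rewrite !rmorph1.
- by rewrite !linearP /= fu fv.
- by rewrite !rmorphM /= fu fv.
rewrite -[f _]mulr1 -(rmorph1 g) -(lX_mulV i) rmorphM /= -eqX mulrA.
by rewrite -(rmorphM f) (mulrC (lXV k i)) lX_mulV rmorph1 mul1r.
Qed.

Definition derivation (d : L -> L) :=
  linear d /\ forall f g, d (f * g) = d f * g + f * d g.

Lemma derivation_nat d m : derivation d -> d m%:R = 0.
Proof.
move=> [lind Ld]; have d1 : d 1 = 0.
  have := Ld 1 1; rewrite !mulr1 mul1r => /eqP.
  by rewrite addrC -subr_eq subrr eq_sym => /eqP.
rewrite -[m%:R]addr0 -scaler_nat lind d1 scaler0 add0r.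
by have := lind (-1) 0 0; rewrite scaler0 addr0 scaleN1r addNr.
Qed.

Lemma derivation_eq0 d : derivation d -> (forall i, d (lX k i) = 0) ->
  forall f, d f = 0.
Proof.
move=> der_d dX; have [lind Ld] := der_d.
have d1 : d 1 = 0 := derivation_nat 1 der_d.
apply: laurent_ind => [//|c f g df dg|f g df dg|//|i].
- by rewrite lind df dg scaler0 addr0.
- by rewrite Ld df dg mul0r mulr0 addr0.
have := Ld (lX k i) (lXV k i).
rewrite lX_mulV d1 dX mul0r add0r => /(congr1 ( *%R (lXV k i))).
by rewrite mulr0 mulrA (mulrC (lXV k i)) lX_mulV mul1r.
Qed.

Lemma lderiv_exists i : exists d : L -> L,
  derivation d /\ forall j, d (lX k j) = (i == j)%:R.
Proof.
(* The identities are isolated over an arbitrary commutative ring, where [ring] only meets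
   variables; [V] stands for 1/x_i and [MV], [RV], [SV] for inverse monomials. *)
have shift_id (A : comNzRingType) (dP P Q V MV RV : A) (a b : nat) :
    (dP * Q + P * (b%:R * (V * Q)) - (a + b)%:R * (V * (P * Q))) * (MV * RV) =
    (dP - a%:R * (V * P)) * MV * (Q * RV) by ring.
have lin_id (A : comNzRingType) (c dP dQ P Q V MV : A) (a : nat) :
    (c * dP + dQ - a%:R * (V * (c * P + Q))) * MV =
    c * ((dP - a%:R * (V * P)) * MV) + (dQ - a%:R * (V * Q)) * MV by ring.
have leibniz_id (A : comNzRingType) (dP dQ P Q V MV SV : A) (a b : nat) :
    (dP * Q + P * dQ - (a + b)%:R * (V * (P * Q))) * (MV * SV) =
    (dP - a%:R * (V * P)) * MV * (Q * SV) +
    P * MV * ((dQ - b%:R * (V * Q)) * SV) by ring.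
(* The quotient rule for p / x^m. [Eexp] shows that it does not change when the fraction is expanded
   by a monomial, hence that it depends only on the Laurent polynomial. *)
pose E p (m : 'X_{1..n}) : L :=
  (lpoly p^`M(i) - (m i)%:R * (lXV k i * lpoly p)) * lmonV m.
have XU (r : 'X_{1..n}) : lpoly 'X_[r]^`M(i) = (r i)%:R * (lXV k i * lpoly
  'X_[r]).
  rewrite mderivX linearZ /= scaler_nat -[lpoly _ *+ _]mulr_natl.
  have [->|nz] := eqVneq (r i) 0%N; first by rewrite !mul0r.
  congr (_ * _); rewrite -{2}(submK (m := U_(i)) (m' := r)) ?lep1mP // mpolyXD.
  rewrite rmorphM /= -[lpoly 'X_i]/(lX k i) mulrCA (mulrC _ (lX k i)) lX_mulV.
  by rewrite mulr1.
have Eexp p m r : E (p * 'X_[r]) (m + r)%MM = E p m.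
  rewrite /E mderivM rmorphD !rmorphM /= XU mnmDE lmonVD.
  rewrite -[RHS]mulr1 -[X in _ = _ * X](lpolyX_mulV r).
  exact: shift_id.
have /choice[r rE] : forall f : L, exists r : {mpoly k[n]} * 'X_{1..n},
    f = lpoly r.1 * lmonV r.2.
  by move=> f; have [p [m fE]] := laurent_fracE f; exists (p, m).
pose d f := E (r f).1 (r f).2.
have dE p m : d (lpoly p * lmonV m) = E p m.
  have := rE (lpoly p * lmonV m); rewrite /d;
    case: (r _) => q s /= /lfrac_eq pq.
  by rewrite -(Eexp q s m) -(Eexp p m s) pq addmC.
exists d; split; first split.
- move=> c f g; have [p [q [m [-> ->]]]] := laurent_common f g.
  rewrite scalerAl -mulrDl -linearP !dE /E linearP /= !linearP /=.
  have scE (u : L) : c *: u = laurent_const n c * u by [].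
  rewrite !scE.
  exact: lin_id.
- move=> f g; have [p [m ->]] := laurent_fracE f;
    have [q [s ->]] := laurent_fracE g.
  rewrite mulrACA -rmorphM -lmonVD !dE /E mderivM rmorphD !rmorphM /= lmonVD.
  rewrite mnmDE.
  exact: leibniz_id.
move=> j; have := dE 'X_j 0%MM.
rewrite lmonV0 mulr1 /E mnm0E mul0r subr0 mderivX mnm1E => ->.
rewrite /lmonV big1 ?mulr1; last by move=> l _; rewrite mnm0E.
rewrite eq_sym; case: eqVneq => [->|_]; last by rewrite scale0r raddf0.
by rewrite scale1r -{1}[U_(j)%MM]add0m addmK mpolyX0 rmorph1.
Qed.

Definition lderiv i : L -> L := sval (cid (lderiv_exists i)).

Lemma lderivP i : derivation (lderiv i).
Proof. by rewrite /lderiv; case: cid => d []. Qed.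

Lemma lderivX i j : lderiv i (lX k j) = (i == j)%:R.
Proof. by rewrite /lderiv; case: cid => d []. Qed.

Lemma derivation_lin (c : k) d e : derivation d -> derivation e ->
  derivation (fun f => c *: d f + e f).
Proof.
move=> [lind Ld] [line Le]; split=> [a f g|f g].
  rewrite lind line !scalerDr !scalerA (mulrC c) -!addrA; congr (_ + _).
  by rewrite addrCA.
rewrite Ld Le scalerDr mulrDl mulrDr -scalerAl -scalerAr -!addrA; congr (_ + _).
by rewrite addrCA.
Qed.

Lemma derivation_mull g d : derivation d -> derivation (fun f => g * d f).
Proof.
move=> [lind Ld]; split=> [a f h|f h]; first by rewrite lind mulrDr scalerAr.
by rewrite Ld mulrDr mulrA mulrCA.
Qed.

Lemma derivation_comm d e : derivation d -> derivation e ->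
  derivation (fun f => d (e f) - e (d f)).
Proof.
move=> [lind Ld] [line Le].
have dD f g : d (f + g) = d f + d g by rewrite -[f]scale1r lind !scale1r.
have eD f g : e (f + g) = e f + e g by rewrite -[f]scale1r line !scale1r.
split=> [a f g|f g]; first by rewrite !lind !line !lind scalerBr opprD addrACA.
have comm_id (A : comNzRingType) (df eg ef dg def deg edf edg u v : A) :
    def * v + ef * dg + (df * eg + u * deg) -
    (edf * v + df * eg + (ef * dg + u * edg)) =
    (def - edf) * v + u * (deg - edg) by ring.
by rewrite Ld Le dD eD !Ld !Le; apply: comm_id.
Qed.

Lemma derivation_sum (I : finType) (F : I -> L -> L) :
  (forall i, derivation (F i)) -> derivation (fun f => \sum_i F i f).
Proof.
move=> derF; split=> [a f g|f g].
  rewrite scaler_sumr -big_split; apply: eq_bigr => i _ /=.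
  by rewrite (derF i).1.
rewrite mulr_suml mulr_sumr -big_split; apply: eq_bigr => i _ /=.
exact: (derF i).2.
Qed.

Lemma derivationE d : derivation d ->
  forall f, d f = \sum_i d (lX k i) * lderiv i f.
Proof.
move=> der_d f; pose e f := \sum_i d (lX k i) * lderiv i f.
have der_e : derivation e.
  by apply: derivation_sum => i; apply/derivation_mull/lderivP.
suff /(_ f)/eqP : forall f, -1 *: d f + e f = 0.
  by rewrite scaleN1r addrC subr_eq0 => /eqP.
apply: derivation_eq0 (derivation_lin _ der_d der_e) _ => j.
rewrite /e (bigD1 j) //= lderivX eqxx mulr1 big1 => [|i /negPf ij].
  by rewrite addr0 scaleN1r addNr.
by rewrite lderivX ij mulr0.
Qed.

Lemma lderiv_comm i j f : lderiv i (lderiv j f) = lderiv j (lderiv i f).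
Proof.
apply/eqP; rewrite -subr_eq0; apply/eqP.
apply: derivation_eq0 (derivation_comm (lderivP i) (lderivP j)) _ f => l.
by rewrite !lderivX !derivation_nat ?subrr //; apply: lderivP.
Qed.

End LaurentTheory.

(** * Differential operators on the torus *)

Section DiffopTheory.
Variables (k : fieldType) (n : nat).
Local Notation L := (laurent k n).
Local Notation D := (diffop L).

Lemma diffop_addE (P Q : D) f : (P + Q) f = P f + Q f.
Proof. by []. Qed.
Lemma diffop_mulE (P Q : D) f : (P * Q) f = P (Q f).
Proof. by []. Qed.
Lemma diffop_oppE (P : D) f : (- P) f = - P f.
Proof. by []. Qed.
Lemma mulop_subproof (g : L) : is_diffop (fun f : L => g * f).
Proof.
apply/asboolP; split=> [c u v|]; first by rewrite mulrDr scalerAr.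
by exists 0%N => a f; rewrite mulrCA.
Qed.
Definition mulop g : D := DiffOp (mulop_subproof g).

Lemma mulop_linear : linear mulop.
Proof. by move=> c f g; apply: diffopP => h /=; rewrite mulrDl -scalerAl. Qed.
Lemma mulop_mul : monoid_morphism mulop.
Proof.
split=> [|f g]; apply: diffopP => h /=; first by rewrite mul1r.
by rewrite mulrA.
Qed.
HB.instance Definition _ := GRing.isLinear.Build k L D *:%R mulop mulop_linear.
HB.instance Definition _ := GRing.isMonoidMorphism.Build L D mulop mulop_mul.

Lemma mulop_inj : injective mulop.
Proof.
by move=> f g /(congr1 (fun P : D => P 1)) /=; rewrite !mulr1.
Qed.

Lemma derop_subproof i : is_diffop (@lderiv k n i).
Proof.
have [lind Ld] := lderivP k i; apply/asboolP; split=> //.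
by exists 1%N => a b f; rewrite /= !Ld !addrK mulrCA.
Qed.
Definition derop i : D := DiffOp (derop_subproof i).

Lemma ad_derop i f : ad (derop i) (mulop f) = mulop (lderiv i f).
Proof.
have [_ Ld] := lderivP k i; apply: diffopP => g.
by rewrite diffop_addE diffop_oppE !diffop_mulE /= Ld addrK.
Qed.

Lemma ad_derop_lX i j : ad (derop i) (mulop (lX k j)) = (i == j)%:R.
Proof. by rewrite ad_derop lderivX rmorph_nat. Qed.

Lemma derop_comm i j : derop i * derop j = derop j * derop i.
Proof. by apply: diffopP => f; rewrite !diffop_mulE /= lderiv_comm. Qed.

Lemma derivation_diffopE (P : D) : derivation P ->
  P = \sum_i mulop (P (lX k i)) * derop i.
Proof.
move=> derP; apply: diffopP => f; rewrite (derivationE derP).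
have sumE (F : 'I_n -> D) : (\sum_i F i) f = \sum_i F i f.
  by elim/big_rec2: _ => // i u Q _ <-.
by rewrite sumE.
Qed.

Lemma diffop_order (P : D) : exists d, diff_order_le d P.
Proof. by case: P => P PP; have /asboolP[_] := PP. Qed.

Lemma ad_mulop_order d (P : D) g : diff_order_le d.+1 P ->
  diff_order_le d (ad P (mulop g)).
Proof. by move=> /(_ g). Qed.

Lemma ad_mulop0 (P : D) : diff_order_le 0 P -> P = mulop (P 1).
Proof. by move=> P0; apply: diffopP => f /=; rewrite mulrC -P0 mulr1. Qed.

Hypothesis char0 : forall m, m.+1%:R != 0 :> k.

Section Generation.
Variable S : D -> Prop.
Hypotheses (S_lin : forall c P Q, S P -> S Q -> S (c *: P + Q))
  (S_mul : forall P Q, S P -> S Q -> S (P * Q))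
  (S_mulop : forall f, S (mulop f)) (S_derop : forall i, S (derop i)).

Let SD P Q : S P -> S Q -> S (P + Q).
Proof. by move=> SP SQ; rewrite -[P]scale1r; apply: S_lin. Qed.
Let S0 : S 0.
Proof. by rewrite -(rmorph0 mulop). Qed.
Let SZ c P : S P -> S (c *: P).
Proof. by move=> SP; rewrite -[_ *: _]addr0; apply: S_lin. Qed.
Let SB P Q : S P -> S Q -> S (P - Q).
Proof. by move=> SP SQ; rewrite addrC -scaleN1r; apply: S_lin. Qed.

Let delta i (P : D) := ad P (mulop (lX k i)).

Let delta0 i : delta i 0 = 0.
Proof. by rewrite /delta /ad mul0r mulr0 subrr. Qed.

Let delta_lin i c P Q : delta i (c *: P + Q) = c *: delta i P + delta i Q.
Proof.
rewrite /delta /ad mulrDl mulrDr -scalerAl -scalerAr scalerBr opprD.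
by rewrite addrACA.
Qed.

Let delta_mul i P Q : delta i (P * Q) = P * delta i Q + delta i P * Q.
Proof. exact: adMl. Qed.

Let delta_nilp i P : exists m, iter m.+1 (delta i) P = 0.
Proof.
have [d dP] := diffop_order P; exists d; elim: d P dP => [|d IHd] P dP.
  apply: diffopP => f; rewrite [iter _ _ _]/(P * _ - _ * P).
  by rewrite diffop_addE diffop_oppE !diffop_mulE dP subrr.
by rewrite iterSr; apply: IHd; apply: ad_mulop_order.
Qed.

Let delta_derop i j m : delta i (derop j ^+ m) = if i == j then m%:R *: derop j
  ^+ m.-1 else 0.
Proof.
have adN (x y : D) : ad x y = - ad y x by rewrite /ad opprB.
rewrite /delta adN (@ad_exp k _ _ _ (- (i == j)%:R)); last first.
  by rewrite adN ad_derop_lX scaleNr scaler_nat eq_sym.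
case: eqP => _; first by rewrite mulrN scaleNr opprK mulr1.
by rewrite oppr0 mulr0 scale0r oppr0.
Qed.

(* The alternating Taylor sum of the iterated commutators with x_i commutes with
   x_i. *)
Let taylor i (P : D) m :=
  \sum_(j < m) ((-1) ^+ j / (j`!)%:R) *: (iter j (delta i) P * derop i ^+ j).

(** As [d_i, x_i] = 1, the two Leibniz terms of consecutive summands cancel. Only the last one
    survives, and it vanishes when [m] bounds the order of [P]. *)
Let delta_taylor i P m : delta i (taylor i P m.+1) =
  ((-1) ^+ m / (m`!)%:R) *: (iter m.+1 (delta i) P * derop i ^+ m).
Proof.
have deltaD Q Q' : delta i (Q + Q') = delta i Q + delta i Q'.
  by rewrite -[Q]scale1r delta_lin !scale1r.
have deltaZ c Q : delta i (c *: Q) = c *: delta i Q.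
  by rewrite -[c *: Q]addr0 delta_lin delta0 addr0.
elim: m => [|m IHm]; rewrite /taylor big_ord_recr /= deltaD deltaZ delta_mul.
  by rewrite big_ord0 delta0 add0r delta_derop eqxx scale0r mulr0 add0r.
rewrite -/(taylor i P m.+1) IHm delta_derop eqxx /= scalerDr addrA -scalerAr
  scalerA.
rewrite -[X in X + _ + _]scale1r -[RHS]add0r; congr (_ + _).
rewrite scalerA -scalerDl mul1r factS natrM.
suff -> : (-1) ^+ m / (m`!)%:R + (-1) ^+ m.+1 / (m.+1%:R * (m`!)%:R) * m.+1%:R =
  0 :> k.
  by rewrite scale0r.
by rewrite invfM mulrCA mulrAC mulVf // mul1r exprS mulN1r mulNr subrr.
Qed.

(** The variables are treated one at a time. The Taylor sum of P' has P' as its term of index 0, and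
    all further terms contain an iterated commutator of P', so they lie in [S]. Commutation with the
    earlier x_i persists, since commutators with different x_i commute and [d_i0, x_i] = 0. *)
Let eliminate (P : D) : (forall l, S (delta l P)) ->
  forall j, (j <= n)%N -> exists P', S (P - P') /\
    forall i : 'I_n, (i < j)%N -> delta i P' = 0.
Proof.
move=> SdP; elim=> [_|j IHj lt_jn].
  by exists P; split=> //; rewrite subrr.
have [P' [SPP' dP']] := IHj (ltnW lt_jn); pose i0 := Ordinal lt_jn.
have SdP' l : S (delta l P').
  have -> : P' = (-1) *: (P - P') + P by rewrite scaleN1r opprB subrK.
  rewrite delta_lin; apply: S_lin => //; rewrite /delta.
  by apply: SB; apply: S_mul.
have [m dm0] := delta_nilp i0 P'; exists (taylor i0 P' m.+1); split=> [|i].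
  rewrite /taylor big_ord_recl /= expr0 fact0 invr1 mulr1 scale1r mulr1.
  rewrite opprD addrA; apply: SB => //.
  elim/big_ind: _ => // l _; apply: SZ; apply: S_mul.
    rewrite add0n -iterS iterSr; elim: (l : nat) => [|r IHr] //=.
    by apply: SB; apply: S_mul.
  by elim: (bump 0 l) => [|r IHr];
    rewrite ?expr0 -?(rmorph1 mulop) ?exprS //; apply: S_mul.
rewrite ltnS leq_eqVlt => /orP[/eqP ij|ij].
  have -> : i = i0 by apply: val_inj.
  by rewrite delta_taylor dm0 mul0r scaler0.
have ii0 : i != i0 by apply: contraTneq ij => ->; rewrite ltnn.
have delta_comm Q : delta i Q = 0 -> delta i (delta i0 Q) = 0.
  rewrite /delta => Q0; have xx : ad (mulop (lX k i0)) (mulop (lX k i)) = 0.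
    by apply: ad_comm; rewrite /GRing.comm -!rmorphM mulrC.
  by rewrite [ad Q (mulop (lX k i0))]/ad adBl !adMl xx Q0 !(mul0r, mulr0, add0r)
    oppr0.
rewrite /taylor; elim/big_ind: _ => [//|Q Q' Q0 Q0'|l _].
  by rewrite -[Q]scale1r delta_lin Q0 Q0' scaler0 addr0.
rewrite -[_ *: _]addr0 delta_lin delta0 addr0 delta_mul delta_derop (negPf ii0).
rewrite mulr0 add0r; suff -> : delta i (iter l (delta i0) P') = 0.
  by rewrite mul0r scaler0.
by elim: (l : nat) => [|r IHr] /=; [apply: dP'|apply: delta_comm].
Qed.

(** Induction on the order: the commutators with the x_l have smaller order, so [eliminate] applies.
    The remaining operator commutes with all x_i, hence with all Laurent polynomials, and is
    therefore a multiplication operator. *)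
Lemma diffop_generated P : S P.
Proof.
have [d dP] := diffop_order P; elim: d P dP => [|d IHd] P dP.
  by rewrite (ad_mulop0 dP).
have SdP l : S (delta l P) by apply/IHd/ad_mulop_order.
have [P' [SPP' dP']] := eliminate SdP (leqnn n).
have P'C f : ad P' (mulop f) = 0.
  move: f; apply: laurent_ind => [|c f g cf cg|f g cf cg|i|i].
  - by rewrite rmorph1 ad_comm //; apply: commr1.
  - rewrite linearP /= adD cg addr0 /ad -scalerAr -scalerAl -scalerBr.
    by rewrite [_ - _]cf scaler0.
  - by rewrite rmorphM adMr cf cg mul0r mulr0 addr0.
  - exact: dP'.
  apply/eqP; rewrite subr_eq0; apply/eqP.
  have xV : mulop (lX k i) * mulop (lXV k i) = 1 by rewrite -rmorphM lX_mulV
    rmorph1.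
  have Vx : mulop (lXV k i) * mulop (lX k i) = 1 by rewrite -rmorphM mulrC
    lX_mulV rmorph1.
  have Px := ad_eq0 (dP' i (ltn_ord i)).
  by rewrite -[LHS]mul1r -{1}Vx -!mulrA (mulrA _ P') -Px -mulrA xV mulr1.
have -> : P = (P - P') + mulop (P' 1).
  rewrite -(@ad_mulop0 P') ?subrK // => a f.
  by have /(congr1 (fun Q : D => Q f)) := ad_eq0 (P'C a).
exact: SD.
Qed.

End Generation.

End DiffopTheory.

(** * Actions induced on differential operators and on their fractions *)

Section ActionConstruction.
Variables (k : fieldType) (gT : finGroupType) (G : {group gT}).

(** Injectivity is asked of every [F g], even for [g] outside [G], because [is_action] demands it;
    the constructions below take the identity as the default value there. *)
Lemma action_of_morphisms (A : algType k) (F : gT -> {lrmorphism A -> A}) :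
  (forall g, injective (F g)) ->
  {in G &, forall g h x, F (g * h)%g x = F h (F g x)} ->
  exists c : action G A, acts_by_automorphisms c /\ forall x g, c x g = F g x.
Proof.
move=> injF FM; have actF : is_action G (fun x g => F g x).
  by split=> [g|x g h Gg Gh] /=; [apply: injF|apply: FM].
exists (Action actF); split=> [g _|//] /=.
by split; [apply: linearP|split; [apply: rmorph1|apply: rmorphM]].
Qed.

Variable n : nat.
Local Notation L := (laurent k n).
Local Notation D := (diffop L).

Lemma diff_order_conj d (s t : {lrmorphism L -> L}) (P : L -> L) :
  cancel s t -> cancel t s -> diff_order_le d P ->
  diff_order_le d (fun f => s (P (t f))).
Proof.
move=> st ts; elim: d P => [|d IHd] P /= dP a.
  by move=> f; rewrite rmorphM dP rmorphM /= ts.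
apply: diff_order_ext (IHd _ (dP (t a))) => f.
by rewrite /= rmorphB !rmorphM /= ts.
Qed.

Lemma conj_diffop_exists (s t : {lrmorphism L -> L}) :
  cancel s t -> cancel t s -> exists F : {lrmorphism D -> D},
  injective F /\ forall P f, F P f = s (P (t f)).
Proof.
move=> st ts; have FP (P : D) : is_diffop (fun f => s (P (t f))).
  apply/asboolP; split=> [c f g|].
    by rewrite linearP /= diffop_linear linearP.
  have [d dP] := diffop_order P; exists d; exact: diff_order_conj.
pose F P : D := DiffOp (FP P).
have F_lin : linear F.
  move=> c P Q; apply: diffopP => f /=.
  by rewrite -[LHS]/(s (c *: P (t f) + Q (t f))) linearP.
have F_mul : monoid_morphism F.
  split=> [|P Q]; apply: diffopP => f /=; first by rewrite -[LHS]/(s (t f)) ts.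
  by rewrite -[LHS]/(s (P (Q (t f)))) -[RHS]/(s (P (t (s (Q (t f)))))) st.
exists (algebra_morphism F_lin F_mul); split=> // P Q eqF.
apply: diffopP => f; have /= := congr1 (fun R : D => R (s f)) eqF.
by rewrite !st; apply: (can_inj st).
Qed.

Lemma induced_action_exists (a : action G L) : acts_by_automorphisms a ->
  exists b : action G D, acts_by_automorphisms b /\ induced_action a b.
Proof.
move=> auta; have /choice[F FE] : forall g, exists F : {lrmorphism D -> D},
    injective F /\ (g \in G -> forall P f, F P f = a (P (a f g^-1%g)) g).
  move=> g; have [Gg|] := boolP (g \in G); last first.
    by exists idfun; split=> [P Q|].
  have [s sE] := act_lrmorphism auta Gg.
  have [t tE] := act_lrmorphism auta (groupVr Gg).
  have [] := @conj_diffop_exists s t.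
  - by move=> f; rewrite -sE -tE act_mulK.
  - by move=> f; rewrite -sE -tE act_mulVK.
  by move=> F [injF FE]; exists F; split=> // _ P f; rewrite FE sE tE.
have [||b [autb bE]] := action_of_morphisms (F := F).
- by move=> g; case: (FE g).
- move=> g h Gg Gh P; apply: diffopP => f.
  have [_ /(_ (groupM Gg Gh)) ->] := FE (g * h)%g; have [_ /(_ Gh) ->] := FE h.
  have [_ /(_ Gg) ->] := FE g.
  by rewrite act_mul // invMg act_mul ?groupV.
exists b; split=> // g Gg P f; rewrite bE.
by have [_ /(_ Gg) ->] := FE g; rewrite act_mulK.
Qed.

Lemma extended_action_exists (A : algType k) (K : unitAlgType k)
    (iota : {lrmorphism A -> K}) (b : action G A) :
  is_skew_fraction_field iota -> acts_by_automorphisms b ->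
  exists c : action G K, acts_by_automorphisms c /\
    {in G, forall g x, c (iota x) g = iota (b x g)}.
Proof.
move=> fracK autb; have [skewK injK _] := fracK.
have /choice[F FE] : forall g, exists F : {lrmorphism K -> K},
    injective F /\ (g \in G -> forall x, F (iota x) = iota (b x g)).
  move=> g; have [Gg|] := boolP (g \in G); last first.
    by exists idfun; split=> [P Q|].
  have [s sE] := act_lrmorphism autb Gg.
  have [|F [injF FE]] := extension_exists (phi := iota \o s) fracK skewK.
    move=> x y /= /injK; rewrite -!sE => /(congr1 (fun z => b z g^-1%g)).
    by rewrite !act_mulK.
  by exists F; split=> // _ x; rewrite FE /= sE.
have [||c [autc cE]] := action_of_morphisms (F := F).
- by move=> g; case: (FE g).
- move=> g h Gg Gh; apply: (extension_unique fracK (g := F h \o F g)) => x /=.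
  have [_ /(_ (groupM Gg Gh)) ->] := FE (g * h)%g.
  have [_ /(_ Gg) ->] := FE g; have [_ /(_ Gh) ->] := FE h.
  by rewrite act_mul.
exists c; split=> // g Gg x; rewrite cE.
by have [_ /(_ Gg) ->] := FE g.
Qed.

End ActionConstruction.

(** * Invariants of the skew field of fractions *)

Section GenericInvariants.
Variables (k : fieldType) (n : nat).
Hypothesis char0 : forall m, m.+1%:R != 0 :> k.
Local Notation L := (laurent k n).
Local Notation D := (diffop L).
Variables (K : unitAlgType k) (iota : {lrmorphism D -> K}).
Hypothesis fracK : is_skew_fraction_field iota.
Variables (gT : finGroupType) (G : {group gT}) (a : action G L).
Hypothesis auta : acts_by_automorphisms a.
Variable b : action G D.
Hypothesis ind_b : induced_action a b.
Variable c : action G K.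
Hypotheses (autc : acts_by_automorphisms c) (ext_c : extends_action iota b c).

Variable y : 'I_n -> L.
Hypothesis fixed_y : forall i, {in G, forall g, a (y i) g = y i}.
(* The invariants are rational functions in the y_i. *)
Hypothesis y_generate : forall Q : subalgClosed L, division_closed Q ->
  (forall i, y i \in Q) -> forall f, {in G, forall g, a f g = f} -> f \in Q.

Let skewK (z : K) : z != 0 -> z \is a GRing.unit.
Proof. by case: fracK => skewK _ _; apply: skewK. Qed.

Let injK : injective iota.
Proof. by case: fracK. Qed.

Definition mu (f : L) : K := iota (mulop f).

Lemma mu_linear : linear mu.
Proof. by move=> r f g; rewrite /mu !linearP. Qed.
Lemma mu_mul : monoid_morphism mu.
Proof. by split=> [|f g]; rewrite /mu ?rmorph1 ?rmorphM. Qed.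
HB.instance Definition _ := GRing.isLinear.Build k L K *:%R mu mu_linear.
HB.instance Definition _ := GRing.isMonoidMorphism.Build L K mu mu_mul.

Lemma mu_inj : injective mu.
Proof. by move=> f g /injK/mulop_inj. Qed.

Lemma mu_unit f : f != 0 -> mu f \is a GRing.unit.
Proof. by move=> nzf; apply: skewK; rewrite raddf_eq0 //; apply: mu_inj. Qed.

Lemma mu_comm f g : mu f * mu g = mu g * mu f.
Proof. by rewrite -!rmorphM mulrC. Qed.

Lemma mu_act f g : g \in G -> c (mu f) g = mu (a f g).
Proof.
move=> Gg; rewrite /mu ext_c //; congr (iota _).
have [s sE] := act_lrmorphism auta Gg.
apply: diffopP => h; rewrite -[h](act_mulVK a h Gg) ind_b //=.
by rewrite !sE rmorphM.
Qed.

(** The field M of rational functions on the torus, found inside [K] instead of being constructed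
    separately. *)
Definition is_ratfun : {pred K} :=
  fun z => `[< exists f g, g != 0 /\ z = mu f / mu g >].

Lemma mu_ratfun f : is_ratfun (mu f).
Proof.
by apply/asboolP; exists f, 1; rewrite oner_neq0 rmorph1 divr1.
Qed.

Let L_mulf_neq0 (f g : L) : f != 0 -> g != 0 -> f * g != 0.
Proof. by move=> nzf; apply: contra_neq => /laurent_mulf_eq0/(_ nzf). Qed.

Let mu_mulV f g : g != 0 -> mu f * (mu g)^-1 = (mu g)^-1 * mu f.
Proof.
move=> nzg; rewrite -[RHS](mulrK (mu_unit nzg)) -(mulrA _ (mu f)) mu_comm.
by rewrite mulKr ?mu_unit.
Qed.

Let mu_mulVV f g : f != 0 -> g != 0 -> (mu f)^-1 * (mu g)^-1 = (mu (g * f))^-1.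
Proof. by move=> nzf nzg; rewrite rmorphM /= invrM ?mu_unit. Qed.

Let mu_expand f g h : g != 0 -> h != 0 -> mu f / mu g = mu (f * h) / mu (g * h).
Proof.
move=> nzg nzh; rewrite !rmorphM /= invrM ?mu_unit //.
by rewrite mulrA mulrK ?mu_unit.
Qed.

Lemma ratfun_closed : divalg_closed is_ratfun.
Proof.
split=> [|r _ _ /asboolP[f [g [nzg ->]]] /asboolP[f' [g' [nzg' ->]]]|
  _ _ /asboolP[f [g [nzg ->]]] /asboolP[f' [g' [nzg' ->]]]].
- by rewrite -(rmorph1 mu); apply: mu_ratfun.
- apply/asboolP; exists (r *: (f * g') + f' * g), (g * g').
  split; first exact: L_mulf_neq0 nzg nzg'.
  rewrite (mu_expand f nzg nzg') (mu_expand f' nzg' nzg) (mulrC g' g).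
  by rewrite linearP /= mulrDl scalerAl.
have [->|nzf'] := eqVneq f' 0.
  rewrite rmorph0 mul0r invr0 mulr0 -(rmorph0 mu); exact: mu_ratfun.
apply/asboolP; exists (f * g'), (g * f'); split;
  first exact: L_mulf_neq0 nzg nzf'.
rewrite invrM ?unitrV ?mu_unit // invrK -mulrA (mulrA _ (mu g')) -mu_mulV //.
by rewrite -mulrA mu_mulVV // (mulrC f') mulrA -rmorphM.
Qed.

Definition ratfun : divalgClosed K := divalg_pred ratfun_closed.

Lemma mu_in f : mu f \in ratfun.
Proof. exact: mu_ratfun. Qed.

Lemma ratfun_comm : {in ratfun &, commutative *%R}.
Proof.
move=> _ _ /asboolP[f [g [nzg ->]]] /asboolP[f' [g' [nzg' ->]]].
have mulE u u' v v' : v != 0 -> v' != 0 ->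
    mu u / mu v * (mu u' / mu v') = mu (u * u') / mu (v' * v).
  move=> nzv nzv'; rewrite -mulrA (mulrA _ (mu u')) -mu_mulV //.
  by rewrite -mulrA mu_mulVV // mulrA -rmorphM.
by rewrite !mulE // (mulrC f) (mulrC g).
Qed.

Lemma ratfun_act g z : g \in G -> z \in ratfun -> c z g \in ratfun.
Proof.
move=> Gg /asboolP[f [h [nzh ->]]]; have [s sE] := act_lrmorphism autc Gg.
have : mu (a f g) / mu (a h g) \in ratfun by rewrite rpred_div ?mu_in.
by rewrite sE rmorphM rmorphV ?mu_unit //= -!sE !mu_act.
Qed.

Local Notation KG := (fixed skewK autc).
Local Notation MG := (fixedM skewK autc ratfun).

Lemma mu_fixed f : (mu f \in KG) -> {in G, forall g, a f g = f}.
Proof. by move=> /fixedP fixf g Gg; apply: mu_inj; rewrite -mu_act ?fixf. Qed.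

Lemma fixed_mu f : {in G, forall g, a f g = f} -> mu f \in KG.
Proof. by move=> fixf; apply/fixedP => g Gg; rewrite mu_act ?fixf. Qed.

(** Passes from invariant Laurent polynomials to invariant rational functions. Multiplying numerator
    and denominator by the other conjugates of the denominator turns the latter into its norm, which
    is invariant; the numerator is then invariant too. *)
Lemma ratfun_fixed_generated (Q : divalgClosed K) :
  (forall i, mu (y i) \in Q) -> forall z, z \in MG -> z \in Q.
Proof.
move=> Qy; have Qmu f : {in G, forall g, a f g = f} -> mu f \in Q.
  pose S : {pred L} := fun f => mu f \in Q.
  have SE g : (g \in S) = (mu g \in Q) by [].
  have S_closed : subalg_closed S.
    split=> [|r g h|g h]; rewrite !SE; first by rewrite rmorph1 rpred1.
      by move=> Qg Qh; rewrite linearP /= rpredD ?rpredZ.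
    by move=> Qg Qh; rewrite rmorphM rpredM.
  apply: (y_generate (Q := subalg_pred S_closed)) => [q g nzq Qq Qqg|i].
    have Qg : (mu q)^-1 * mu (q * g) \in Q by rewrite rpredM ?rpredVr.
    by rewrite rmorphM mulKr ?mu_unit in Qg.
  exact: Qy.
move=> z; rewrite fixedME => /andP[/asboolP[f [h [nzh zE]]] fz].
pose h' := \prod_(g in G | g != 1%g) a h g; pose N := \prod_(g in G) a h g.
have NE : N = h * h' by rewrite /N (bigD1 1%g) //= act_one.
have nzN : N != 0.
  rewrite /N; elim/big_ind: _ => [|u v nzu nzv|g Gg]; first exact: oner_neq0.
    exact: L_mulf_neq0 nzu nzv.
  apply: contra_neq nzh => ag0; rewrite -(act_mulK a h Gg) ag0.
  by have [s ->] := act_lrmorphism auta (groupVr Gg); rewrite rmorph0.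
have nzh' : h' != 0 by apply: contra_neq nzN; rewrite NE => ->; rewrite mulr0.
have fixN : {in G, forall g, a N g = N}.
  move=> g Gg; have [s sE] := act_lrmorphism auta Gg.
  rewrite sE rmorph_prod [RHS](reindex_inj (mulIg g)) /=.
  apply: eq_big => [h0|h0 Gh0]; first by rewrite groupMr.
  by rewrite -sE act_mul.
rewrite (mu_expand f nzh nzh') -NE in zE.
rewrite zE rpred_div ?Qmu //; apply: mu_fixed.
have -> : mu (f * h') = z * mu N by rewrite zE (divrK (mu_unit nzN)).
by rewrite rpredM ?fixed_mu.
Qed.

Definition delop i : K := iota (derop k i).

Lemma ad_delop_mu i f : ad (delop i) (mu f) = mu (lderiv i f).
Proof. by rewrite /delop /mu -rmorph_ad ad_derop. Qed.

Lemma ad_ratfun P : (forall f, ad P (mu f) \in ratfun) ->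
  forall z, z \in ratfun -> ad P z \in ratfun.
Proof.
move=> adP z /asboolP[f [g [nzg ->]]]; have Ug := mu_unit nzg.
have adV : ad P (mu g)^-1 = - (mu g)^-1 * ad P (mu g) / mu g.
  have : ad P (mu g * (mu g)^-1) = 0 by rewrite divrr // ad_comm //;
    apply: commr1.
  rewrite adMr addrC => /eqP; rewrite addr_eq0 => /eqP adE.
  by rewrite -[LHS](mulKr Ug) adE mulrN !mulNr mulrA.
rewrite adMr adV rpredD // rpredM ?rpredV ?mu_in //.
by rewrite rpredM ?rpredV ?mu_in // rpredM // rpredN rpredV mu_in.
Qed.

Definition vector_field (P : K) : Prop :=
  exists f : 'I_n -> K, (forall i, f i \in ratfun) /\ P = \sum_i f i * delop i.

Lemma vector_field_delop i : vector_field (delop i).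
Proof.
exists (fun j => (j == i)%:R); split=> [j|]; first exact: rpred_nat.
rewrite (bigD1 i) //= eqxx mul1r big1 ?addr0 // => j /negPf ->.
by rewrite mul0r.
Qed.

Lemma vector_field0 : vector_field 0.
Proof.
exists (fun=> 0); split=> [_|]; first exact: rpred0.
by rewrite big1 // => i _; rewrite mul0r.
Qed.

Lemma vector_fieldD P Q : vector_field P -> vector_field Q -> vector_field (P +
  Q).
Proof.
move=> [f [Mf ->]] [g [Mg ->]]; exists (fun i => f i + g i).
split=> [i|]; first by rewrite rpredD.
by rewrite -big_split; apply: eq_bigr => i _; rewrite mulrDl.
Qed.

Lemma vector_fieldZ z P : z \in ratfun -> vector_field P -> vector_field (z *
  P).
Proof.
move=> Mz [f [Mf ->]]; exists (fun i => z * f i).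
split=> [i|]; first by rewrite rpredM.
by rewrite mulr_sumr; apply: eq_bigr => i _; rewrite mulrA.
Qed.

Lemma vector_fieldB P Q : vector_field P -> vector_field Q -> vector_field (P -
  Q).
Proof.
move=> VP VQ; apply: vector_fieldD => //; rewrite -mulN1r.
by apply: vector_fieldZ => //; rewrite rpredN rpred1.
Qed.

Lemma vector_field_sum (I : finType) (F : I -> K) :
  (forall i, vector_field (F i)) -> vector_field (\sum_i F i).
Proof.
move=> VF; elim/big_ind: _ => //; [exact: vector_field0|exact: vector_fieldD].
Qed.

Lemma ad_ratfun_mull z P w : z \in ratfun -> w \in ratfun ->
  ad (z * P) w = z * ad P w.
Proof.
move=> Mz Mw; rewrite adMl [ad z w]ad_comm ?mul0r ?addr0 //.
exact: ratfun_comm.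
Qed.

Lemma ad_vector_field (f : 'I_n -> K) w : (forall i, f i \in ratfun) ->
  w \in ratfun -> ad (\sum_i f i * delop i) w = \sum_i f i * ad (delop i) w.
Proof.
move=> Mf Mw; transitivity (\sum_i ad (f i * delop i) w).
  by rewrite /ad mulr_suml mulr_sumr -sumrB.
by apply: eq_bigr => i _; rewrite ad_ratfun_mull.
Qed.

Lemma ad_delop_ratfun i z : z \in ratfun -> ad (delop i) z \in ratfun.
Proof. by apply: ad_ratfun => f; rewrite ad_delop_mu mu_in. Qed.

Lemma vector_field_ad P z : vector_field P -> z \in ratfun -> ad P z \in ratfun.
Proof.
move=> [f [Mf ->]] Mz; rewrite ad_vector_field // rpred_sum // => i _.
by rewrite rpredM // ad_delop_ratfun.
Qed.

Lemma vector_field_eq0 P : vector_field P ->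
  (forall z, z \in ratfun -> ad P z = 0) -> P = 0.
Proof.
move=> [f [Mf ->]] adP0; rewrite big1 // => i _.
suff -> : f i = 0 by rewrite mul0r.
rewrite -(adP0 _ (mu_in (lX k i))) ad_vector_field ?mu_in //.
rewrite (bigD1 i) //= ad_delop_mu lderivX eqxx rmorph1 mulr1.
rewrite big1 ?addr0 // => j /negPf ji.
by rewrite ad_delop_mu lderivX ji rmorph0 mulr0.
Qed.

(* A derivation killing the y_i kills the fixed field, over which all rational
   functions are algebraic. *)
Lemma vector_field_inj P : vector_field P -> (forall i, ad P (mu (y i)) = 0) ->
  P = 0.
Proof.
move=> VP adPy; apply: vector_field_eq0 => //;
  have adPM z := vector_field_ad VP (z := z).
apply: (ad_fixed_ad0 char0 (skewK := skewK) (autc := autc) ratfun_act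
  ratfun_comm adPM).
pose C : {pred K} := fun z => `[< ad P z = 0 >].
have C_closed : divalg_closed C.
  split=> [|r u v /asboolP Pu /asboolP Pv|u v /asboolP Pu /asboolP Pv];
    apply/asboolP.
  - by apply: ad_comm; apply: commr1.
  - rewrite adD Pv addr0 /ad -scalerAr -scalerAl -scalerBr -/(ad P u) Pu.
    exact: scaler0.
  rewrite adMr Pu mul0r add0r [ad P v^-1]ad_comm ?mulr0 //.
  by apply: commrV; apply: ad_eq0.
move=> z MGz; apply/asboolP.
apply: (ratfun_fixed_generated (Q := divalg_pred C_closed)) MGz => i.
exact/asboolP.
Qed.

Lemma ad_delop_vector_field P i : vector_field P -> vector_field (ad P (delop
  i)).
Proof.
move=> [f [Mf ->]].
have -> : ad (\sum_j f j * delop j) (delop i) = \sum_j - ad (delop i) (f j) *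
  delop j.
  rewrite /ad mulr_suml mulr_sumr -sumrB; apply: eq_bigr => j _.
  rewrite -!mulrA [delop j * _](_ : _ = delop i * delop j).
    by rewrite mulNr mulrBl opprB !mulrA.
  by rewrite /delop -!rmorphM derop_comm.
exists (fun j => - ad (delop i) (f j)); split=> [j|//].
by rewrite rpredN ad_delop_ratfun.
Qed.

Lemma vector_field_comm P Q : vector_field P -> vector_field Q -> vector_field
  (ad P Q).
Proof.
move=> VP [f [Mf ->]]; rewrite ad_sum; apply: vector_field_sum => i.
rewrite adMr; apply: vector_fieldD; apply: vector_fieldZ => //.
- exact: vector_field_ad.
- exact: vector_field_delop.
- exact: ad_delop_vector_field.
Qed.

Lemma vector_field_act P g : g \in G -> vector_field P -> vector_field (c P g).
Proof.
move=> Gg [f [Mf ->]]; have [s sE] := act_lrmorphism autc Gg.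
rewrite sE rmorph_sum; apply: vector_field_sum => i; rewrite rmorphM /= -!sE.
apply: vector_fieldZ; first exact: ratfun_act.
(* The conjugate of a partial derivative by [g] is a derivation of the Laurent polynomials, hence a
   combination of the partial derivatives. *)
rewrite /delop ext_c // (@derivation_diffopE _ _ (b (derop k i) g)).
  rewrite rmorph_sum; apply: vector_field_sum => j; rewrite rmorphM.
  by apply: vector_fieldZ; [apply: mu_in|apply: vector_field_delop].
split=> [|u v]; first exact: diffop_linear.
have [t tE] := act_lrmorphism auta Gg.
have bE w : b (derop k i) g w = t (lderiv i (a w g^-1%g)).
  by rewrite -[w in LHS](act_mulVK a w Gg) ind_b // tE.
have [t' t'E] := act_lrmorphism auta (groupVr Gg).
have tt' w : t (t' w) = w by rewrite -tE -t'E act_mulVK.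
by rewrite !bE !t'E rmorphM /= (lderivP k i).2 rmorphD !rmorphM /= !tt'.
Qed.

(** Takes the place of inverting the Jacobian matrix of the y_j. The extra unknown of index 0 makes
    the system homogeneous: sum_l d_l(y_j) z_l = delta_ij z_0 has n equations in n+1 unknowns. *)
Lemma dual_vector_fields : exists d : 'I_n -> K,
  (forall i, vector_field (d i)) /\
  forall i j, ad (d i) (mu (y j)) = (i == j)%:R.
Proof.
suff /choice[d dE] : forall i, exists d, vector_field d /\
    forall j, ad d (mu (y j)) = (i == j)%:R.
  by exists d; split=> [i|i j]; have [] := dE i.
move=> i; pose A (j : 'I_n) (l : 'I_n.+1) : K :=
  if unlift ord0 l is Some l' then ad (delop l') (mu (y j)) else - (i == j)%:R.
have [j l|z [Mz [l0 nzl0] eqz]] := skew_solve (Q := ratfun) (A := A) skewK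
  (leqnn _).
  rewrite /A; case: unliftP => [l' _|_]; first by rewrite ad_delop_ratfun
    ?mu_in.
  by rewrite rpredN rpred_nat.
pose e := \sum_l z (lift ord0 l) * delop l.
have Ve : vector_field e by exists (fun l => z (lift ord0 l)).
have ad_e j : ad e (mu (y j)) = (i == j)%:R * z ord0.
  rewrite ad_vector_field ?mu_in //; apply/eqP; rewrite -subr_eq0 addrC -mulNr.
  rewrite -[X in _ == X](eqz j) big_ord_recl {1}/A unlift_none; apply/eqP.
  congr (_ + _); apply: eq_bigr => l _; rewrite /A liftK.
  by apply: ratfun_comm; rewrite ?ad_delop_ratfun ?mu_in.
(* If z_0 were 0, the field [e] would kill all y_j and hence be 0; its coefficients, read off as
   brackets with the x_l, would vanish, so the solution would be trivial. *)
have nz0 : z ord0 != 0.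
  apply: contra_neq nzl0 => z0.
  case: (unliftP ord0 l0) => [l ->|->//].
  have e0 : e = 0.
    by apply: vector_field_inj => // j; rewrite ad_e z0 mulr0.
  transitivity (ad e (mu (lX k l))); last by rewrite e0 /ad mul0r mulr0 subrr.
  rewrite ad_vector_field ?mu_in // (bigD1 l) //= ad_delop_mu lderivX eqxx.
  rewrite rmorph1 mulr1 big1 ?addr0 // => j /negPf jl.
  by rewrite ad_delop_mu lderivX jl rmorph0 mulr0.
have MV : (z ord0)^-1 \in ratfun by rewrite rpredV.
exists ((z ord0)^-1 * e); split=> [|j]; first exact: vector_fieldZ.
rewrite ad_ratfun_mull ?mu_in // ad_e mulrA -[_^-1 * _]ratfun_comm ?rpred_nat
  //.
by rewrite mulrVK ?skewK.
Qed.


Variables (Fn : unitAlgType k) (jota : {lrmorphism weyl k n -> Fn}).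
Hypothesis fracF : is_skew_fraction_field jota.

Lemma generic_invariants_iso : invariants_iso (G := G) Fn c.
Proof.
have [d [Vd dy]] := dual_vector_fields.
have yM i : mu (y i) \in ratfun := mu_in _.
have act_d g i : g \in G -> c (d i) g = d i.
  move=> Gg; have [s sE] := act_lrmorphism autc Gg.
  apply/eqP; rewrite -subr_eq0; apply/eqP; apply: vector_field_inj => [|j].
    by apply: vector_fieldB => //; apply: vector_field_act.
  have yg : mu (y j) = s (mu (y j)) by rewrite -sE mu_act // fixed_y.
  rewrite adBl dy {1}yg sE -rmorph_ad /= dy rmorph_nat subrr //.
have [f [fX fD]] : exists f : {lrmorphism weyl k n -> K},
    (forall i, f (weyl_pi (WX k i)) = mu (y i)) /\
    (forall i, f (weyl_pi (WD k i)) = d i).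
  apply: weyl_map_exists => i j.
  - exact: mu_comm.
  (* By the Jacobi identity [d_i, d_j] kills every y_l, because the brackets of the d_i with the y_l
     are constants. *)
  - apply: ad_eq0; apply: vector_field_inj => [|l];
      first exact: vector_field_comm.
    by rewrite jacobi !dy !ad_comm ?subrr //; apply: commr_nat.
  - apply/eqP; rewrite -subr_eq0 opprD addrA subr_eq0; apply/eqP.
    by rewrite scaler_nat -dy.
have [Phi [injPhi PhiE]] := extension_exists (phi := f) fracF skewK
  (weyl_morph_inj char0 (f := f)).
pose isQ : {pred K} := fun z => `[< exists u, Phi u = z >].
have Q_closed : divalg_closed isQ.
  have [skewF _ _] := fracF.
  split=> [|r _ _ /asboolP[u <-] /asboolP[v <-]|_ _ /asboolP[u <-] /asboolP[v
    <-]].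
  - by apply/asboolP; exists 1; rewrite rmorph1.
  - by apply/asboolP; exists (r *: u + v); rewrite linearP.
  have [->|nzv] := eqVneq v 0.
    by rewrite rmorph0 invr0 mulr0; apply/asboolP; exists 0; rewrite rmorph0.
  by apply/asboolP; exists (u / v); rewrite rmorphM rmorphV ?skewF.
pose Q := divalg_pred Q_closed.
have PhiQ u : Phi u \in Q by apply/asboolP; exists u.
have yQ i : mu (y i) \in Q by rewrite -fX -PhiE PhiQ.
have dQ i : d i \in Q by rewrite -fD -PhiE PhiQ.
have weyl_in (S : divalgClosed K) : (forall i, mu (y i) \in S) ->
    (forall i, d i \in S) -> forall u, f u \in S.
  move=> Sy Sd; elim/weyl_ind; elim=> [i|i|r|s IHs t IHt|s IHs t IHt].
  - by rewrite fX.
  - by rewrite fD.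
  - by rewrite weyl_constE linearZ rmorph1 rpredZ ?rpred1.
  - by rewrite -weyl_addqE [f _](rmorphD f) rpredD.
  by rewrite -weyl_mulqE [f _](rmorphM f) rpredM.
have fixQ z : z \in Q -> z \in KG.
  move=> /asboolP[u <-]; have [_ _ fracE] := fracF.
  have [v [w [nzw ->]]] := fracE u; have [skewF injF _] := fracF.
  have Uw : jota w \is a GRing.unit by apply: skewF; rewrite raddf_eq0.
  have fKG : forall v, f v \in KG.
    apply: weyl_in => i; first exact: fixed_mu.
    by apply/fixedP => g Gg; apply: act_d.
  have : f v / f w \in KG by rewrite rpred_div ?fKG.
  by rewrite rmorphM rmorphV //= !PhiE.
have MGQ := ratfun_fixed_generated (Q := Q) yQ.
have [r [bas [Mbas spanM]]] := artin_basis skewK char0 autc ratfun_act.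
(* This is MQ: [bas] spans M over M^W, and M^W lies in [Q] by [MGQ]. *)
pose V := rspan Q bas.
have VM m q : m \in ratfun -> q \in Q -> V (m * q).
  move=> Mm Qq; apply: rspanZ => //; have [p [Mp ->]] := spanM m Mm.
  by exists p; split=> // i; apply: MGQ.
have stable t : (forall i q, q \in Q -> V (t * (bas i * q))) ->
    forall v, V v -> V (t * v).
  move=> Vt v [q [Qq ->]]; rewrite mulr_sumr; apply: rspan_sum => i.
  exact: Vt.
have stableM t v : t \in ratfun -> V v -> V (t * v).
  move=> Mt; apply: stable => i q Qq; rewrite mulrA; apply: VM => //.
  by rewrite rpredM.
(* d_i b q = b (d_i q) + [d_i, b] q, where d_i q is in [Q] and [d_i, b] is in M. *)
have stable_d i v : V v -> V (d i * v).
  apply: stable => j q Qq.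
  have -> : d i * (bas j * q) = bas j * (d i * q) + ad (d i) (bas j) * q.
    by rewrite /ad mulrBl !mulrA addrC subrK.
  apply: rspanD; apply: VM => //; first by rewrite rpredM.
  exact: vector_field_ad.
(* The chain rule: both sides are vector fields with the same brackets with the y_j. *)
have delopE i : delop i = \sum_j ad (delop i) (mu (y j)) * d j.
  apply/eqP; rewrite -subr_eq0; apply/eqP; apply: vector_field_inj => [|j].
    apply: vector_fieldB; first exact: vector_field_delop.
    apply: vector_field_sum => j; apply: vector_fieldZ => //.
    by rewrite ad_delop_ratfun.
  rewrite {1}/ad mulrBl mulrBr opprD addrACA -opprD -/(ad _ _) mulr_suml
    mulr_sumr.
  rewrite -sumrB (bigD1 j) //= big1 => [|l lj].
    rewrite addr0 -/(ad (ad _ _ * _) _) ad_ratfun_mull ?ad_delop_ratfun //.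
    by rewrite dy eqxx mulr1 subrr.
  rewrite -/(ad (ad _ _ * _) _) ad_ratfun_mull ?ad_delop_ratfun //.
  by rewrite dy (negPf lj) mulr0.
have stableD P v : V v -> V (iota P * v).
  move: P v; apply: (diffop_generated char0) => [t P P' VP VP' v Vv|P P' VP VP'
    v Vv|g v Vv|i v Vv].
  - rewrite linearP /= mulrDl -scalerAl -mulr_algr; apply: rspanD;
      last exact: VP'.
    by apply: rspanZ; [apply: VP|rewrite rpredZ ?rpred1].
  - by rewrite rmorphM -mulrA; apply/VP/VP'.
  - by apply: stableM => //; apply: mu_in.
  rewrite -/(delop i) delopE mulr_suml; apply: rspan_sum => j.
  rewrite -mulrA; apply: stableM; last exact: stable_d.
  by rewrite ad_delop_ratfun.
have V1 : V 1 by rewrite -[1]mulr1; apply: VM; rewrite rpred1.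
have VK z : V z.
  have [_ _ /(_ z)[P [P' [nzP' ->]]]] := fracK; apply/stableD.
  apply: inv_in_span => // [|j]; first by rewrite raddf_eq0.
  by elim: j => [//|j IHj]; rewrite exprS; apply: stableD.
exists Phi; split=> // z; split=> [[u <-]|fz]; first exact/fixedP/fixQ.
suff /asboolP : z \in Q by [].
have Uw : (#|G|%:R : K) \is a GRing.unit by apply: skewK;
  apply: card_group_neq0.
rewrite -[z](mulKr Uw) rpredM ?rpredVr ?rpred_nat //.
rewrite -(fixed_trace (skewK := skewK) (autc := autc)); last exact/fixedP.
have [q [Qq ->]] := VK z; rewrite (trace_sum_fixed (skewK := skewK) (autc :=
  autc)).
  rewrite rpred_sum // => i _; rewrite rpredM // MGQ //.
  exact: (trace_fixedM skewK autc ratfun_act).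
by move=> i; apply: fixQ.
Qed.

End GenericInvariants.

Lemma noether_of_generators (k : fieldType) (n : nat)
    (K : unitAlgType k) (iota : {lrmorphism diffop (laurent k n) -> K})
    (Fn : unitAlgType k) (jota : {lrmorphism weyl k n -> Fn})
    (gT : finGroupType) (G : {group gT})
    (natural : action G (laurent k n) -> Prop) (a : action G (laurent k n))
    (y : 'I_n -> laurent k n) :
  (forall m, m.+1%:R != 0 :> k) ->
  is_skew_fraction_field iota -> is_skew_fraction_field jota ->
  acts_by_automorphisms a -> natural a ->
  (forall i, {in G, forall g, a (y i) g = y i}) ->
  (forall Q : subalgClosed (laurent k n), division_closed Q ->
    (forall i, y i \in Q) ->
    forall f, {in G, forall g, a f g = f} -> f \in Q) ->
  noncommutative_noether (G := G) natural Fn iota.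
Proof.
move=> char0 fracK fracF auta nat_a fixed_y y_gen.
have [b [autb ind_b]] := induced_action_exists auta.
have [c [autc ext_c]] := extended_action_exists fracK autb.
exists a; split=> //; exists b; split=> //; exists c; split=> //.
exact: (generic_invariants_iso char0 fracK auta ind_b autc ext_c
  fixed_y y_gen fracF).
Qed.

Lemma Z2_eq1 (x : 'Z_2) : x != 0 -> x = 1.
Proof. by case: x => [[|[|m]]] // ? _; apply: val_inj. Qed.

(** * The action of the hyperoctahedral group *)

Section SignedMorphisms.
Variables (k : fieldType) (n : nat) (e : k).
Hypothesis e2 : e * e = 1.
Local Notation L := (laurent k n).

Definition signX (v : 'rV['Z_2]_n) i : L :=
  if v 0 i == 0 then lX k i else e *: lXV k i.
Definition signXV (v : 'rV['Z_2]_n) i : L :=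
  if v 0 i == 0 then lXV k i else e *: lX k i.

Lemma signX_mulV v i : signX v i * signXV v i = 1.
Proof.
rewrite /signX /signXV; case: ifP => _; first exact: lX_mulV.
by rewrite -scalerAl -scalerAr scalerA e2 scale1r mulrC lX_mulV.
Qed.

Lemma signed_morph_exists (w : Bn n) : exists f : {lrmorphism L -> L},
  (forall i, f (lX k i) = signX w.2 (w.1 i)) /\
  (forall i, f (lXV k i) = signXV w.2 (w.1 i)).
Proof. by apply: laurent_morph_exists => i; apply: signX_mulV. Qed.

Definition signed_morph w := sval (cid (signed_morph_exists w)).

Lemma signed_morphX w i : signed_morph w (lX k i) = signX w.2 (w.1 i).
Proof. by rewrite /signed_morph; case: cid => f []. Qed.

Lemma signed_morphXV w i : signed_morph w (lXV k i) = signXV w.2 (w.1 i).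
Proof. by rewrite /signed_morph; case: cid => f []. Qed.

(** An element permutes the indices first and then changes signs at the new indices. The signs of
    [w] are thus carried along by the permutation of [w'], as in the semidirect product, and two
    changes at one index cancel because [e * e = 1]. *)
Lemma signed_morphM w w' f :
  signed_morph (w * w')%g f = signed_morph w' (signed_morph w f).
Proof.
move: f; apply: (laurent_morph_eq (g := signed_morph w' \o signed_morph w)) =>
  i.
rewrite /= !signed_morphX {1}/signX /= permM !mxE permK.
rewrite {1}/signX; have [-> | /Z2_eq1 ->] := eqVneq (w.2 0 (w.1 i)) 0.
  by rewrite add0r signed_morphX.
rewrite linearZ /= signed_morphXV /signXV.
have [-> | /Z2_eq1 ->] := eqVneq (w'.2 0 (w'.1 (w.1 i))) 0;
  first by rewrite addr0.
by rewrite scalerA e2 scale1r.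
Qed.

Lemma Bn_permE (s : 'S_n) : (Bn_perm s).1 = s /\ (Bn_perm s).2 = 0.
Proof.
by rewrite /Bn_perm /sdpair2; have -> := val_insubd (sdprod_one _) (s, 1%g);
  rewrite !inE.
Qed.

Lemma Bn_signE v : (Bn_sign v).1 = 1%g :> 'S_n /\ (Bn_sign v).2 = v.
Proof.
by rewrite /Bn_sign /sdpair1; have -> := val_insubd (sdprod_one _) (1%g, v);
  rewrite !inE.
Qed.

Lemma signed_morph1 f : signed_morph 1%g f = f.
Proof.
move: f; apply: (laurent_morph_eq (g := idfun)) => i.
by rewrite signed_morphX /signX /= mxE eqxx perm1.
Qed.

Lemma signed_morph_inj w : injective (signed_morph w).
Proof.
apply: (can_inj (g := signed_morph w^-1%g)) => f.
by rewrite -signed_morphM mulgV signed_morph1.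
Qed.

Lemma signed_morph_perm s i : signed_morph (Bn_perm s) (lX k i) = lX k (s i).
Proof. by rewrite signed_morphX /signX; have [-> ->] := Bn_permE s;
  rewrite mxE eqxx. Qed.

Lemma signed_morph_sign v i : signed_morph (Bn_sign v) (lX k i) = signX v i.
Proof. by rewrite signed_morphX; have [-> ->] := Bn_signE v; rewrite perm1. Qed.

Lemma signed_action_exists (G : {group Bn n}) : exists a : action G L,
  [/\ acts_by_automorphisms a, signed_natural e a & forall f w, a f w =
    signed_morph w f].
Proof.
have [|a [auta aE]] := action_of_morphisms (G := G) signed_morph_inj.
  by move=> w w' _ _ f; apply: signed_morphM.
exists a; split=> //; split=> [s i _|v i _]; rewrite aE.
  exact: signed_morph_perm.
exact: signed_morph_sign.
Qed.

Lemma perm_action_exists : exists a : action [set: 'S_n] L,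
  [/\ acts_by_automorphisms a, Sn_natural a &
    forall f s, a f s = signed_morph (Bn_perm s) f].
Proof.
have [||a [auta aE]] := action_of_morphisms (G := [set: 'S_n]%G)
    (F := fun s => signed_morph (Bn_perm s)).
- by move=> s; apply: signed_morph_inj.
- move=> s t _ _ f; rewrite -signed_morphM; congr (signed_morph _ f).
  exact: (sdpair2_morphM (sign_groupAction n)) (in_setT _) (in_setT _).
by exists a; split=> // s i; rewrite aE signed_morph_perm.
Qed.

End SignedMorphisms.

Lemma subalg_rpredB (k : pzRingType) (A : lalgType k) (S : subalgClosed A) (x y
  : A) :
  x \in S -> y \in S -> x - y \in S.
Proof. by move=> Sx Sy; rewrite -scaleN1r rpredD ?rpredZ. Qed.

(** * Generators of the commutative invariants *)

Section Evaluation.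
Variables (k : fieldType) (n : nat).
Local Notation L := (laurent k n).

Definition leval (h : 'I_n -> L) (p : {mpoly k[n]}) : L := mmap (in_alg L) h p.

Lemma leval_linear h : linear (leval h).
Proof. by move=> c p q; rewrite /leval mmapD mmapZ /= -scalerAl mul1r. Qed.
Lemma leval_mul h : monoid_morphism (leval h).
Proof. by split=> [|p q]; rewrite /leval ?rmorph1 ?rmorphM. Qed.
HB.instance Definition _ h :=
  GRing.isLinear.Build k {mpoly k[n]} L *:%R (leval h) (leval_linear h).
HB.instance Definition _ h :=
  GRing.isMonoidMorphism.Build {mpoly k[n]} L (leval h) (leval_mul h).

Lemma levalX h (m : 'X_{1..n}) : leval h 'X_[m] = \prod_i h i ^+ m i.
Proof. exact: mmapX. Qed.

Lemma levalXU h i : leval h 'X_i = h i.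
Proof. by rewrite /leval mmapX mmap1U. Qed.

Lemma mpoly_lin_eq (V : lmodType k) (f g : {mpoly k[n]} -> V) :
  linear f -> linear g -> (forall m, f 'X_[m] = g 'X_[m]) -> f =1 g.
Proof.
move=> linf ling fg; have lin0 (h : {mpoly k[n]} -> V) : linear h -> h 0 = 0.
  by move=> linh; have := linh (-1) 0 0; rewrite scaler0 addr0 scaleN1r addNr.
elim/mpolyind=> [|c m p _ _ IHp]; first by rewrite !lin0.
by rewrite linf ling IHp fg.
Qed.

Lemma leval_lX p : leval (@lX k n) p = lpoly p.
Proof.
move: p; apply: mpoly_lin_eq => [||m]; [exact: leval_linear|exact:
  lpoly_linear|].
by rewrite levalX lpolyX.
Qed.

Lemma leval_in (S : subalgClosed L) h p : (forall i, h i \in S) -> leval h p \in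
  S.
Proof.
move=> Sh; apply: rpred_sum => m _; rewrite -scalerAl mul1r rpredZ //.
by apply: rpred_prod => i _; apply: rpredX.
Qed.

Lemma leval_morph (s : {lrmorphism L -> L}) h p :
  s (leval h p) = leval (fun i => s (h i)) p.
Proof.
move: p; apply: mpoly_lin_eq => [c p q|c p q|m]; first by rewrite !linearP.
  exact: leval_linear.
by rewrite !levalX rmorph_prod; apply: eq_bigr => i _; rewrite rmorphXn.
Qed.

Lemma leval_comp h (g : 'I_n -> {mpoly k[n]}) p :
  leval h (mmap (@mpolyC n k) g p) = leval (fun i => leval h (g i)) p.
Proof.
move: p; apply: mpoly_lin_eq => [c p q|c p q|m].
- by rewrite mmapD mmapZ mul_mpolyC linearP.
- exact: leval_linear.
rewrite levalX mmapX /mmap1 rmorph_prod.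
by apply: eq_bigr => i _; rewrite rmorphXn.
Qed.

Lemma leval_msym h (s : 'S_n) p : leval h (msym s p) = leval (fun i => h (s i))
  p.
Proof.
rewrite /msym leval_comp; congr (leval _ p); apply/funext => i.
exact: levalXU.
Qed.

Section Symmetric.
Variables (S : subalgClosed L) (h : 'I_n -> L).
Hypothesis mesym_in : forall i : 'I_n, leval h (mesym n k i.+1) \in S.

Lemma leval_symmetric_in p : p \is symmetric -> leval h p \in S.
Proof.
move=> /sym_fundamental[t [<- _]]; rewrite leval_comp; apply: leval_in => i.
by rewrite tnth_mktuple.
Qed.

Hypothesis char0 : forall m, m.+1%:R != 0 :> k.

(** The [h i] are not known to be algebraically independent, so [p] need not be symmetric although
    its value is fixed. Its symmetrization has n! times the same value, and n! is invertible. *)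
Lemma leval_fixed_in (s : 'S_n -> {lrmorphism L -> L}) p :
  (forall t i, s t (h i) = h (t i)) -> (forall t, s t (leval h p) = leval h p)
    ->
  leval h p \in S.
Proof.
move=> sh fixp; pose q := \sum_(t : 'S_n) msym t p.
have symq : q \is symmetric.
  apply/issymP => t; rewrite /q raddf_sum [RHS](reindex_inj (mulIg t)) /=.
  by apply: eq_bigr => t' _; rewrite msymMm.
have qE : leval h q = #|'S_n|%:R *: leval h p.
  rewrite /q linear_sum /= scaler_nat -sumr_const; apply: eq_bigr => t _.
  rewrite leval_msym -[in RHS](fixp t) leval_morph; congr (leval _ p).
  by apply/funext => i; rewrite sh.
have nz : #|'S_n|%:R != 0 :> k.
  by rewrite card_Sn -(prednK (fact_gt0 n)) char0.
rewrite -[leval h p]scale1r -(mulVf nz) -scalerA -qE.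
by rewrite rpredZ // leval_symmetric_in.
Qed.

End Symmetric.

Hypothesis char0 : forall m, m.+1%:R != 0 :> k.

(** The product [N] of the conjugates of a monomial denominator is a symmetric polynomial, and [N]
    times [f] is a fixed polynomial; both lie in [Q], hence so does their quotient. *)
Lemma Sn_generate (Q : subalgClosed L) (s : 'S_n -> {lrmorphism L -> L}) f :
  division_closed Q ->
  (forall i : 'I_n, leval (@lX k n) (mesym n k i.+1) \in Q) ->
  (forall t i, s t (lX k i) = lX k (t i)) -> (forall t, s t f = f) -> f \in Q.
Proof.
move=> divQ Qe sX fixf; have [p [m fE]] := laurent_fracE f.
pose N := \prod_(t : 'S_n) msym t 'X_[m] : {mpoly k[n]}.
have s_lpoly t q : s t (lpoly q) = lpoly (msym t q).
  rewrite -!leval_lX leval_msym leval_morph; congr (leval _ q).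
  by apply/funext => i; apply: sX.
have fixN t : s t (lpoly N) = lpoly N.
  rewrite s_lpoly; congr lpoly; rewrite /N rmorph_prod.
  rewrite [RHS](reindex_inj (mulIg t)) /=.
  by apply: eq_bigr => t' _; rewrite msymMm.
have nzN : lpoly N != 0.
  rewrite /N rmorph_prod; elim/big_ind: _ => [|u v nzu nzv|t _].
  - exact: oner_neq0.
  - by apply: contra_neq nzv => /laurent_mulf_eq0/(_ nzu).
  rewrite /= -s_lpoly; apply: contra_neq (oner_neq0 L) => X0.
  by rewrite -(rmorph1 (s t)) -(lpolyX_mulV k m) rmorphM /= X0 mul0r.
have NfE : lpoly N * f = lpoly (p * \prod_(t : 'S_n | t != 1%g) msym t 'X_[m]).
  rewrite /N (bigD1 1%g) //= msym1m fE !rmorphM /=.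
  by rewrite [lpoly p * _]mulrC mulrACA lpolyX_mulV mul1r mulrC.
have in_Q q : (forall t, s t (lpoly q) = lpoly q) -> lpoly q \in Q.
  by rewrite -leval_lX; apply: leval_fixed_in.
apply: (divQ (lpoly N)) => //; first exact: in_Q.
by rewrite NfE in_Q // => t; rewrite -NfE rmorphM /= fixN fixf.
Qed.

End Evaluation.

(** * Invariants under permutations and all sign changes *)

Section SignedInvariants.
Variables (k : fieldType) (n : nat) (e : k).
Hypothesis e2 : e * e = 1.
Hypothesis char0 : forall m, m.+1%:R != 0 :> k.
Local Notation L := (laurent k n).
Local Notation act := (signed_morph (n := n) e2).

Definition usum i : L := lX k i + e *: lXV k i.

Lemma signed_morph_usum w i : act w (usum i) = usum (w.1 i).
Proof.
rewrite /usum linearD linearZ /= signed_morphX signed_morphXV /signX /signXV.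
by case: ifP => // _; rewrite scalerA e2 scale1r addrC.
Qed.

Definition flip (i : 'I_n) : Bn n := Bn_sign (delta_mx 0 i).

Lemma flip_lX i j :
  act (flip i) (lX k j) = if i == j then e *: lXV k j else lX k j.
Proof.
rewrite /flip signed_morph_sign /signX mxE eqxx /=.
by rewrite [j == i]eq_sym; case: (i == j).
Qed.

Lemma flip_lXV i j : i != j -> act (flip i) (lXV k j) = lXV k j.
Proof.
move=> /negPf ij; rewrite /flip signed_morphXV /signXV.
have [-> ->] := Bn_signE (delta_mx 0 i).
by rewrite perm1 mxE eqxx [j == i]eq_sym ij.
Qed.

Lemma flip_usum i j : act (flip i) (usum j) = usum j.
Proof. by rewrite signed_morph_usum; have [-> _] := Bn_signE (delta_mx 0 i);
  rewrite perm1. Qed.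

(* k[u_0, .., u_{j-1}, x_j^{+-1}, .., x_{n-1}^{+-1}] with u_i = x_i + e / x_i *)
Definition is_mixed (j : nat) : {pred L} := fun f =>
  `[< forall S : subalgClosed L, (forall i : 'I_n, (i < j)%N -> usum i \in S) ->
      (forall i : 'I_n, (j <= i)%N -> lX k i \in S /\ lXV k i \in S) -> f \in S
        >].

Lemma mixed_closed j : subalg_closed (is_mixed j).
Proof.
split=> [|c f g /asboolP Sf /asboolP Sg|f g /asboolP Sf /asboolP Sg];
  apply/asboolP => S Su SX; first exact: rpred1.
  by rewrite rpredD ?rpredZ ?Sf ?Sg.
by rewrite rpredM ?Sf ?Sg.
Qed.

Definition mixed j : subalgClosed L := subalg_pred (mixed_closed j).

Lemma mixed_ind j (S : {pred L}) : subalg_closed S ->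
  (forall i : 'I_n, (i < j)%N -> usum i \in S) ->
  (forall i : 'I_n, (j <= i)%N -> lX k i \in S /\ lXV k i \in S) ->
  forall f, f \in mixed j -> f \in S.
Proof. by move=> clS Su SX f /asboolP/(_ (subalg_pred clS)); apply. Qed.

Lemma usum_mixed (i : 'I_n) j : (i < j)%N -> usum i \in mixed j.
Proof. by move=> lt_ij; apply/asboolP => S Su _; apply: Su. Qed.

Lemma lX_mixed (i : 'I_n) j : (j <= i)%N -> lX k i \in mixed j.
Proof. by move=> le_ji; apply/asboolP => S _ /(_ i le_ji)[]. Qed.

Lemma lXV_mixed (i : 'I_n) j : (j <= i)%N -> lXV k i \in mixed j.
Proof. by move=> le_ji; apply/asboolP => S _ /(_ i le_ji)[]. Qed.

Lemma lX_sqr i : lX k i * lX k i = usum i * lX k i - e%:A.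
Proof. by rewrite /usum mulrDl -scalerAl (mulrC (lXV k i)) lX_mulV addrK. Qed.

(* x_j is quadratic over the next subalgebra: x_j^2 = u_j x_j - e. *)
Lemma mixed_split (j : 'I_n) f : f \in mixed j ->
  exists a b, [/\ a \in mixed j.+1, b \in mixed j.+1 & f = a + b * lX k j].
Proof.
pose S : {pred L} := fun f => `[< exists a b,
  [/\ a \in mixed j.+1, b \in mixed j.+1 & f = a + b * lX k j] >].
have SM a : a \in mixed j.+1 -> a \in S.
  by move=> Ma; apply/asboolP; exists a, 0; rewrite rpred0 mul0r addr0.
have S_closed : subalg_closed S.
  split=> [|c _ _ /asboolP[a [b [Ma Mb ->]]] /asboolP[a' [b' [Ma' Mb' ->]]]|
    _ _ /asboolP[a [b [Ma Mb ->]]] /asboolP[a' [b' [Ma' Mb' ->]]]].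
  - by rewrite SM ?rpred1.
  - apply/asboolP; exists (c *: a + a'), (c *: b + b').
    rewrite !rpredD ?rpredZ //; split=> //.
    by rewrite scalerDr mulrDl scalerAl addrACA.
  apply/asboolP; exists (a * a' - b * b' * e%:A), (a * b' + b * a' + b * b' *
    usum j).
  have Me : e%:A \in mixed j.+1 by rewrite rpredZ ?rpred1.
  split; first by apply: subalg_rpredB; apply: rpredM => //; apply: rpredM.
    by rewrite !rpredD ?rpredM ?usum_mixed.
  have prod_id (A : comNzRingType) (x u r s t s' t' : A) : x * x = u * x - r ->
      (s + t * x) * (s' + t' * x) =
      s * s' - t * t' * r + (s * t' + t * s' + t * t' * u) * x.
    move=> xx; transitivity (s * s' + (s * t' + t * s') * x + t * t' * (x * x)).
      by ring.
    by rewrite xx; ring.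
  exact: prod_id (lX_sqr j).
move=> Mf; suff /asboolP : f \in S by [].
apply: (mixed_ind S_closed) Mf => i.
  by move=> lt_ij; rewrite SM ?usum_mixed // ltnW.
rewrite leq_eqVlt => /orP[/eqP ji|lt_ji]; last first.
  by rewrite !SM ?lX_mixed ?lXV_mixed.
have {i ji}-> : i = j by apply: val_inj.
split; apply/asboolP.
  by exists 0, 1; rewrite rpred0 rpred1 mul1r add0r.
(* 1/x_j = e u_j - e x_j, because e^2 = 1. *)
exists (e *: usum j), (- e%:A); split.
- by rewrite rpredZ // usum_mixed.
- by rewrite -scaleN1r !rpredZ ?rpred1.
rewrite mulNr -scalerAl mul1r /usum scalerDr scalerA e2 scale1r.
by rewrite addrC addKr.
Qed.

Lemma mixed_flip (j : 'I_n) f : f \in mixed j.+1 -> act (flip j) f = f.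
Proof.
pose S : {pred L} := fun f => act (flip j) f == f.
have S_closed : subalg_closed S.
  split=> [|c f' g /eqP Sf /eqP Sg|f' g /eqP Sf /eqP Sg]; apply/eqP.
  - exact: rmorph1.
  - by rewrite linearP /= Sf Sg.
  - by rewrite rmorphM /= Sf Sg.
move=> Mf; suff /eqP : f \in S by [].
apply: (mixed_ind S_closed) Mf => i; first by move=> _; apply/eqP;
  apply: flip_usum.
move=> lt_ji; have neq : j != i by apply: contraTneq lt_ji => ->; rewrite ltnn.
split; apply/eqP; last exact: flip_lXV.
by rewrite flip_lX (negPf neq).
Qed.

(** The flip replaces x_j by the other root u_j - x_j of its quadratic equation. Adding the two
    expressions of a fixed [f] gives 2f = 2a + b u_j, free of x_j. *)
Lemma flip_fixed_mixed (j : 'I_n) f : f \in mixed j -> act (flip j) f = f ->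
  f \in mixed j.+1.
Proof.
move=> /mixed_split[a [b [Ma Mb fE]]] fixf.
have fE2 : f = a + b * (usum j - lX k j).
  rewrite -fixf fE rmorphD rmorphM /= (mixed_flip Ma) (mixed_flip Mb) flip_lX
    eqxx.
  by rewrite /usum [lX k j + _]addrC addrK.
have ff : f + f = a + a + b * usum j.
  by rewrite {1}fE fE2 addrACA -mulrDr [lX k j + _]addrC subrK.
have nz2 : 2%:R != 0 :> k := char0 1.
rewrite -[f]scale1r -(mulVf nz2) -scalerA scaler_nat [f *+ 2]mulr2n ff rpredZ
  //.
by rewrite !rpredD ?rpredM ?usum_mixed.
Qed.

(** The flips are used one index at a time to replace x_j by u_j. What remains is a polynomial in
    the u_i, to which the symmetric case applies. *)
Lemma Bn_generate (Q : subalgClosed L) f :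
  (forall i : 'I_n, leval usum (mesym n k i.+1) \in Q) ->
  (forall w, act w f = f) -> f \in Q.
Proof.
move=> Qe fixf.
have Mf j : (j <= n)%N -> f \in mixed j.
  elim: j => [_|j IHj lt_jn].
    apply/asboolP => S _ SX; move: f {fixf};
      apply: laurent_ind => [|c f g Sf Sg|f g Sf Sg|i|i].
    - exact: rpred1.
    - by rewrite rpredD ?rpredZ.
    - by rewrite rpredM.
    - by have [] := SX i.
    by have [] := SX i.
  by apply: (@flip_fixed_mixed (Ordinal lt_jn)); [apply/IHj/ltnW|].
have [p fE] : exists p, f = leval usum p.
  pose S : {pred L} := fun f => `[< exists p, f = leval usum p >].
  have S_closed : subalg_closed S.
    split=> [|c _ _ /asboolP[p ->] /asboolP[q ->]|_ _ /asboolP[p ->] /asboolP[q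
      ->]];
      apply/asboolP.
    - by exists 1; rewrite rmorph1.
    - by exists (c *: p + q); rewrite linearP.
    - by exists (p * q); rewrite rmorphM.
  suff /asboolP : f \in S by [].
  apply: (mixed_ind S_closed) (Mf n (leqnn n)) => i.
    by move=> _; apply/asboolP; exists 'X_i; rewrite levalXU.
  by rewrite leqNgt ltn_ord.
rewrite fE; apply: (leval_fixed_in Qe char0 (s := fun t => act (Bn_perm t))) =>
  [t i|t].
  by rewrite signed_morph_usum; have [-> _] := Bn_permE t.
by rewrite -fE.
Qed.

End SignedInvariants.

(** * Invariants under permutations and even sign changes *)

Section EvenInvariants.
Variables (k : fieldType) (m : nat).
Hypothesis char0 : forall m, m.+1%:R != 0 :> k.
Local Notation n := m.+2.
Local Notation L := (laurent k n).
Let e2 : 1 * 1 = 1 :> k := mulr1 1.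
Local Notation act := (signed_morph (n := n) e2).
Local Notation u := (usum (n := n) (1 : k)).

Definition parity (w : Bn n) : 'Z_2 := \sum_j w.2 0 j.

Lemma parityM w w' : parity (w * w')%g = parity w + parity w'.
Proof.
rewrite /parity; under eq_bigr => j _ do rewrite !mxE.
rewrite big_split /=; congr (_ + _).
by rewrite (reindex_inj (@perm_inj _ w'.1)) /=; apply: eq_bigr => j _;
  rewrite permK.
Qed.

Lemma DnE w : (w \in Dn n) = (parity w == 0).
Proof. by rewrite inE. Qed.

Definition delta : L := \prod_i (lX k i - lXV k i).

Lemma act_delta w : act w delta = if w \in Dn n then delta else - delta.
Proof.
pose sg (x : 'Z_2) : L := if x == 0 then 1 else -1.
have sgD x y : sg (x + y) = sg x * sg y.
  rewrite /sg; have [->|/Z2_eq1 ->] := eqVneq x 0; first by rewrite add0r mul1r.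
  have [->|/Z2_eq1 ->] := eqVneq y 0; first by rewrite addr0 mulr1.
  by rewrite mulN1r opprK.
rewrite DnE; transitivity (sg (parity w) * delta); last first.
  by rewrite /sg; case: ifP => _; rewrite ?mul1r ?mulN1r.
rewrite /parity (big_morph sg sgD (erefl _)) -big_split /= rmorph_prod.
rewrite [RHS](reindex_inj (@perm_inj _ w.1)); apply: eq_bigr => i _ /=.
rewrite rmorphB /= signed_morphX signed_morphXV /signX /signXV /sg.
by case: ifP => _; rewrite ?mul1r // !scale1r mulN1r opprB.
Qed.

Definition even_gen (i : 'I_n) : L :=
  if (i < m)%N then leval u (mesym n k i.+1)
  else if (i == m :> nat) then \prod_j (u j - 2%:R) else delta.

Lemma even_gen_fixed i w : w \in Dn n -> act w (even_gen i) = even_gen i.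
Proof.
move=> Dw; rewrite /even_gen; case: ifP => _; last case: ifP => _.
- rewrite leval_morph.
  have -> : (fun i => act w (u i)) = fun i => u (w.1 i).
    by apply/funext => j; rewrite signed_morph_usum.
  rewrite -leval_msym; congr leval; apply/issymP; exact: mesym_sym.
- rewrite rmorph_prod [RHS](reindex_inj (@perm_inj _ w.1)).
  by apply: eq_bigr => j _; rewrite rmorphB /= signed_morph_usum rmorph_nat.
by rewrite act_delta Dw.
Qed.

Lemma prod_usum_add (z : k) : \prod_j (u j + z%:A) =
  \sum_(j < n.+1) z ^+ (n - j) *: leval u (mesym n k j).
Proof.
rewrite bigA_distr (partition_big (fun J : {set 'I_n} => inord #|J| : 'I_n.+1)
  predT) //=.
apply: eq_bigr => j _; rewrite /mesym (linear_sum (leval u)) /= scaler_sumr.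
have cardJ (J : {set 'I_n}) : (#|J| < n.+1)%N.
  by rewrite ltnS -[X in (_ <= X)%N]card_ord max_card.
apply: eq_big => [J|J /eqP Jj]; first by rewrite -val_eqE /= inordK.
have cJ : #|J| = j by rewrite -Jj inordK.
rewrite (bigID (mem J)) /= rmorph_prod [LHS]mulrC -[RHS]mulr_algl;
  congr (_ * _).
  rewrite (eq_bigr (fun=> z%:A)); last by move=> i /negPf iJ; rewrite iJ.
  rewrite (eq_bigl (mem (~: J))) => [|i]; last by rewrite /= inE.
  by rewrite prodr_const cardsCs setCK card_ord cJ exprZn expr1n.
by apply: eq_bigr => i iJ; rewrite iJ /= levalXU.
Qed.

(** A witness that the two products below are nonzero: at x_i = 2 their factors u_i - 2 and x_i -
    1/x_i take the values 1/2 and 3/2. *)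
Lemma laurent_eval_two : exists s : {lrmorphism L -> k^o},
  (forall i, s (lX k i) = 2%:R) /\ (forall i, s (lXV k i) = 2%:R^-1).
Proof. by apply: laurent_morph_exists => i; rewrite mulfV // char0. Qed.

Lemma prod_usum_neq0 : \prod_j (u j - 2%:R) != 0.
Proof.
have [s [sX sV]] := laurent_eval_two; have nz2 : 2%:R != 0 :> k := char0 1.
apply: contraTneq isT => /(congr1 s)/eqP; rewrite rmorph0 rmorph_prod.
rewrite prodf_seq_eq0 => /hasP[j _ /=].
rewrite /usum scale1r rmorphB rmorphD /= sX sV rmorph_nat.
by rewrite addrAC subrr add0r invr_eq0 (negPf nz2).
Qed.

Lemma delta_neq0 : delta != 0.
Proof.
have [s [sX sV]] := laurent_eval_two; have nz2 : 2%:R != 0 :> k := char0 1.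
apply: contraTneq isT => /(congr1 s)/eqP; rewrite rmorph0 rmorph_prod.
rewrite prodf_seq_eq0 => /hasP[j _ /=]; rewrite rmorphB /= sX sV.
rewrite subr_eq0 => /eqP/(congr1 ( *%R 2%:R)); rewrite mulfV // => /eqP.
by rewrite -natrM -subr_eq0 -(natrB _ (isT : (1 <= 4)%N)) (negPf (char0 2)).
Qed.

Lemma delta_sqr : delta * delta = \prod_j (u j - 2%:R) * \prod_j (u j + 2%:R).
Proof.
rewrite -!big_split; apply: eq_bigr => j _ /=; rewrite /usum scale1r.
have sq_id (A : comNzRingType) (x y : A) : x * y = 1 ->
    (x - y) * (x - y) = (x + y - 2%:R) * (x + y + 2%:R).
  move=> xy; transitivity ((x + y) * (x + y) - 4%:R * (x * y)); first by ring.
  by rewrite xy; ring.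
exact/sq_id/lX_mulV.
Qed.

(* delta^2 = prod (u_j - 2) prod (u_j + 2), and prod (u_j + 2) - prod (u_j - 2)
   determines the elementary symmetric function of order n - 1 from the lower
   ones; so all of them are rational functions of the generators. *)
Lemma even_gen_mesym (Q : subalgClosed L) : division_closed Q ->
  (forall i, even_gen i \in Q) ->
  forall i : 'I_n, leval u (mesym n k i.+1) \in Q.
Proof.
move=> divQ Qg; pose E j := leval u (mesym n k j).
have Q0 : E 0%N \in Q by rewrite /E mesym0E rmorph1 rpred1.
have Qlow j : (j <= m)%N -> E j \in Q.
  case: j => // j lt_jm; have lt_jn : (j < n)%N by rewrite !ltnS ltnW // ltnW.
  by have := Qg (Ordinal lt_jn); rewrite /even_gen lt_jm.
have QA : \prod_j (u j - 2%:R) \in Q.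
  have lt_mn : (m < n)%N by rewrite ltnS.
  by have := Qg (Ordinal lt_mn); rewrite /even_gen /= ltnn eqxx.
have Qd : delta \in Q.
  by have := Qg ord_max; rewrite /even_gen /= ltnNge leqnSn /= eqn_leq ltnn.
have QB : \prod_j (u j + 2%:R) \in Q.
  by apply: (divQ _ _ prod_usum_neq0 QA); rewrite -delta_sqr rpredM.
have prodE (z : k) : \prod_j (u j + z%:A) =
    \sum_(j < m.+1) z ^+ (n - j) *: E j + z *: E m.+1 + E m.+2.
  by rewrite prod_usum_add !big_ord_recr /= subnn subSnn expr0 expr1 scale1r.
have AE := prodE (- 2%:R); have BE := prodE 2%:R.
rewrite (eq_bigr (fun j => u j - 2%:R)) in AE; last first.
  by move=> j _; rewrite scaleNr scaler_nat.
rewrite (eq_bigr (fun j => u j + 2%:R)) in BE; last first.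
  by move=> j _; rewrite scaler_nat.
have nz4 : 4%:R != 0 :> k := char0 3.
have Qsum (z : k) : \sum_(j < m.+1) z ^+ (n - j) *: E j \in Q.
  by rewrite rpred_sum // => j _; rewrite rpredZ // Qlow // -ltnS.
have Qm1 : E m.+1 \in Q.
  rewrite -[E _]scale1r -(mulVf nz4) -scalerA rpredZ //.
  have -> : 4%:R *: E m.+1 = (\prod_j (u j + 2%:R) - \prod_j (u j - 2%:R)) -
      (\sum_(j < m.+1) 2%:R ^+ (n - j) *: E j -
       \sum_(j < m.+1) (- 2%:R) ^+ (n - j) *: E j).
    rewrite AE BE; move: (\sum_(j < _) _) (\sum_(j < _) _) => s t.
    rewrite scaleNr !scaler_nat; move: (E _) (E _) => v w.
    have telescope (A : comNzRingType) (a b c d : A) :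
        c *+ 4 = (a + c *+ 2 + d) - (b - c *+ 2 + d) - (a - b) by ring.
    exact: telescope.
  by rewrite !subalg_rpredB.
have Qm2 : E m.+2 \in Q.
  have -> : E m.+2 = \prod_j (u j + 2%:R) -
      (\sum_(j < m.+1) 2%:R ^+ (n - j) *: E j + 2%:R *: E m.+1).
    by rewrite BE [_ + E _]addrC addrK.
  by rewrite subalg_rpredB // rpredD ?rpredZ.
move=> i; have := ltn_ord i; rewrite ltnS leq_eqVlt => /orP[/eqP ->//|].
rewrite ltnS leq_eqVlt => /orP[/eqP -> //|lt_im].
exact: Qlow.
Qed.

(** For an odd element [eps], [f] is half the sum of its symmetric and antisymmetric parts under
    [eps]. The first is invariant under the whole signed group; the second changes sign under every
    odd element, and so becomes invariant after multiplication by [delta]. *)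
Lemma Dn_generate (Q : subalgClosed L) f : division_closed Q ->
  (forall i, even_gen i \in Q) ->
  (forall w, w \in Dn n -> act w f = f) -> f \in Q.
Proof.
move=> divQ Qg fixf; pose eps := flip (ord0 : 'I_n).
have Qe := even_gen_mesym divQ Qg.
have par_eps : parity eps = 1.
  rewrite /parity /eps /flip; have [_ ->] := Bn_signE (delta_mx 0 (ord0 :
    'I_n)).
  rewrite (bigD1 ord0) //= mxE !eqxx big1 ?addr0 // => j /negPf j0.
  by rewrite mxE j0 andbF.
have epsD w : w \notin Dn n -> (w * eps)%g \in Dn n /\ (eps * w)%g \in Dn n.
  by rewrite !DnE !parityM par_eps => /Z2_eq1 ->.
(* Every odd [w] is an even element followed by [eps], and the even one fixes [f]. *)
have act_odd w : w \notin Dn n -> act w f = act eps f.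
  move=> Dw; rewrite -[w in LHS](mulgKV eps) signed_morphM fixf // DnE.
  apply/eqP/(addIr 1); rewrite -{1}par_eps -parityM mulgKV add0r.
  by apply: Z2_eq1; rewrite -DnE.
have act_eps w : act w (act eps f) = if w \in Dn n then act eps f else f.
  rewrite -signed_morphM; case: ifP => Dw.
    by apply: act_odd; rewrite DnE parityM par_eps; move: Dw;
      rewrite DnE => /eqP ->.
  by apply: fixf; have [] := epsD w (negbT Dw).
have nz2 : 2%:R != 0 :> k := char0 1.
have Q1 : f + act eps f \in Q.
  apply: (Bn_generate char0 Qe) => w; rewrite rmorphD /= act_eps.
  have [Dw|Dw] := boolP (w \in Dn n); first by rewrite fixf.
  by rewrite act_odd // addrC.
have Qd : delta \in Q.
  by have := Qg ord_max; rewrite /even_gen /= ltnNge leqnSn /= eqn_leq ltnn.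
have Q2 : f - act eps f \in Q.
  apply: (divQ _ _ delta_neq0 Qd).
  apply: (Bn_generate char0 Qe) => w; rewrite rmorphM rmorphB /= act_eps
    act_delta.
  have [Dw|Dw] := boolP (w \in Dn n); first by rewrite fixf.
  by rewrite act_odd // mulNr -mulrN opprB.
rewrite -[f]scale1r -(mulVf nz2) -scalerA scaler_nat [f *+ 2]mulr2n.
have -> : f + f = (f + act eps f) + (f - act eps f) by rewrite addrACA subrr
  addr0.
by rewrite rpredZ // rpredD.
Qed.

End EvenInvariants.

Theorem theorem3 (R : realType) (n : nat)
    (FD : unitAlgType R[i])
    (iota : {lrmorphism diffop (laurent R[i] n) -> FD})
    (Fn : unitAlgType R[i])
    (jota : {lrmorphism weyl R[i] n -> Fn}) :
  is_skew_fraction_field iota -> is_skew_fraction_field jota ->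
  [/\ (1 <= n)%N ->
        noncommutative_noether (G := [set: 'S_n]%G)
          (@Sn_natural R[i] n) Fn iota,
      (2 <= n)%N ->
        noncommutative_noether (G := [set: Bn n]%G)
          (@signed_natural R[i] n (-1) [set: Bn n]%G) Fn iota
    & (4 <= n)%N ->
        noncommutative_noether (G := Dn_group n)
          (@signed_natural R[i] n 1 (Dn_group n)) Fn iota].
Proof.
move=> fracD fracF; have char0 m : m.+1%:R != 0 :> R[i].
  by rewrite Num.Theory.pnatr_eq0.
have sqN1 : -1 * -1 = 1 :> R[i] by rewrite mulN1r opprK.
split=> [_|_|].
- have [a [auta nat_a aE]] := perm_action_exists n (mulr1 1 : 1 * 1 = 1 :>
    R[i]).
  apply: (noether_of_generators (a := a)
    (y := fun i => leval (@lX R[i] n) (mesym n R[i] i.+1)) char0 fracD fracF) =>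
      //.
    move=> i s _; rewrite aE leval_morph.
    rewrite -[in RHS](issymP _ (mesym_sym _ _ _) s) leval_msym.
    by congr (leval _ _); apply/funext => j /=; rewrite signed_morph_perm.
  move=> Q divQ Qy f fixf.
  apply: (Sn_generate char0 (s := fun s => signed_morph (mulr1 1) (Bn_perm s))
    divQ Qy).
    by move=> s i; apply: signed_morph_perm.
  by move=> s; rewrite -aE fixf ?inE.
- have [a [auta nat_a aE]] := signed_action_exists sqN1 [set: Bn n]%G.
  apply: (noether_of_generators (a := a)
    (y := fun i => leval (usum (-1)) (mesym n R[i] i.+1)) char0 fracD fracF) =>
      //.
    move=> i w _; rewrite aE leval_morph.
    rewrite -[in RHS](issymP _ (mesym_sym _ _ _) w.1) leval_msym.
    by congr (leval _ _); apply/funext => j /=; rewrite signed_morph_usum.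
  move=> Q divQ Qy f fixf; apply: (Bn_generate char0 Qy) => w.
  by rewrite -aE fixf ?inE.
case: n iota jota fracD fracF => [|[|m]] // iota jota fracD fracF _.
have [a [auta nat_a aE]] :=
  signed_action_exists (mulr1 1 : 1 * 1 = 1 :> R[i]) (Dn_group m.+2).
apply: (noether_of_generators (a := a) (y := @even_gen R[i] m) char0 fracD
  fracF) => //.
  by move=> i w Dw; rewrite aE even_gen_fixed.
move=> Q divQ Qy f fixf; apply: (Dn_generate char0 divQ Qy) => w Dw.
by rewrite -aE fixf.
Qed.
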